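(* Let $F$ be an alternating shape with $n$ pipes and let $\omega\in\mathfrak S_n$ be sortable on $F$. Then the acyclic order on $\Sigma_F(\omega)$ is a lattice: every two elements of $\Sigma_F(\omega)$ have a meet and a join for the acyclic order.
   Context: Grid cells are unit squares with corners in $\mathbb Z^2$, indexed by their lower-left corner. An alternating shape $F$ (with parameter $n\ge 2$) is a connected finite set of cells whose boundary splits into four paths: a starting path from $(0,0)$ made of $n$ unit steps, each south or east; a NW stair path from $(0,0)$ to $(t_F,t_F)$ with steps $(NE)^{t_F}$, $t_F\ge 0$; an ending path from $(t_F,t_F)$ made of $n$ unit steps, each south or east; and a SE stair path from the endpoint of the starting path to the endpoint of the ending path with steps $(EN)^{b}$, $b\ge0$; the ending path stays strictly north and east of the starting path. A pipe dream on $F$ fills each cell with either a cross (one pipe passing straight horizontally, one straight vertically) or a contact (one elbow joining the west side to the north side, called the NW elbow, and one joining the south side to the east side, called the SE elbow), so that the $n$ pipes entering through the $n$ unit steps of the starting path exit through the $n$ unit steps of the ending path. Pipes are labelled $1,\dots,n$ by their entry step, from northwest to southeast along the starting path; the exit permutation $\omega$ is given by: $\omega(i)$ is the pipe exiting through the $i$-th step of the ending path (counted from northwest to southeast). A pipe dream is reduced if any two pipes cross at most once. $\Pi_F(\omega)$ is the set of reduced pipe dreams on $F$ with exit permutation $\omega$; $\omega$ is sortable on $F$ if $\Pi_F(\omega)\neq\emptyset$. For $a<b$, $(a,b)$ is an inversion of $\omega$ if $\omega^{-1}(b)<\omega^{-1}(a)$ and a noninversion otherwise; the (right) weak order is $\omega_1\le\omega_2$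 iff the inversion set of $\omega_1$ is contained in that of $\omega_2$. The contact graph of $P$ is the directed graph on $\{1,\dots,n\}$ with an arc $a\to b$ iff some contact cell of $P$ has pipe $a$ on its NW elbow and pipe $b$ on its SE elbow. The extended contact graph is obtained by adding all arcs $a\to b$ with $(a,b)$ a noninversion of $\omega$. $P$ is strongly acyclic if its extended contact graph is acyclic. $\Sigma_F(\omega)$ is the set of strongly acyclic pipe dreams in $\Pi_F(\omega)$. For $P\in\Sigma_F(\omega)$, $\operatorname{lin}(P)$ is the set of permutations $\pi$ with $\pi^{-1}(a)<\pi^{-1}(b)$ for every arc $a\to b$ of the extended contact graph of $P$. The acyclic order on $\Sigma_F(\omega)$: $P\le P'$ iff there exist $\pi\in\operatorname{lin}(P)$ and $\pi'\in\operatorname{lin}(P')$ with $\pi\le\pi'$ in the weak order. *)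

(* Defs.v *)
From mathcomp Require Import all_boot all_order all_algebra all_fingroup finmap.
From Stdlib Require Import Relations.

Set Implicit Arguments.
Unset Strict Implicit.
Unset Printing Implicit Defensive.

Import Order.TTheory GRing.Theory Num.Theory.

Local Open Scope ring_scope.

(* A point of Z^2; a cell is given by its lower-left corner. *)
Notation point := (int * int)%type.
Notation cell := (int * int)%type (only parsing).

Definition north : point := (0, 1).
Definition east : point := (1, 0).
Definition south : point := (0, -1).
Definition west : point := (-1, 0).

(* A unit edge of the grid: (true, c) is the horizontal edge from c to c + east,
   that is, the south side of the cell c, and (false, c) is the vertical edge
   from c to c + north, that is, the west side of c. *)
Notation edge := (bool * (int * int))%type.
Definition south_side (c : cell) : edge := (true, c).
Definition west_side (c : cell) : edge := (false, c).
Definition north_side (c : cell) : edge := south_side (c + north).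
Definition east_side (c : cell) : edge := west_side (c + east).

(* Lattice paths are given by their origin and their sequence of unit steps,
   each of which is one of the vectors north, east, south. *)
Definition path_vertex (p : point) (s : seq point) (i : nat) : point :=
  p + \sum_(v <- take i s) v.

Definition step_edge (p v : point) : edge :=
  if v == east then (true, p) else if v == north then (false, p) else (false, p + south).

Definition path_edge (p : point) (s : seq point) (i : nat) : edge :=
  step_edge (path_vertex p s i) (nth 0 s i).

Definition path_edges (p : point) (s : seq point) : seq edge :=
  mkseq (path_edge p s) (size s).

Definition NW_stair (t : nat) : seq point := flatten (nseq t [:: north; east]).
Definition SE_stair (b : nat) : seq point := flatten (nseq b [:: east; north]).

Definition adjacent (c d : cell) : bool := d - c \in [:: north; east; south; west].

(* The i-th vertices of the starting and ending paths lie on a common line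
   x - y = i, so strictness is a comparison of vertices of equal index.  The
   first (resp. last) vertices of the two paths coincide when t = 0 (resp.
   b = 0), hence strictness is only required at the inner vertices. *)
Record alternating_shape (n : nat) : Type := AlternatingShape {
  cells :> {fset cell};
  starting : n.-tuple point;
  ending : n.-tuple point;
  nw_length : nat;
  se_length : nat;
  nw_corner : point := (nw_length%:Z, nw_length%:Z);
  starting_steps : all (mem [:: south; east]) starting;
  ending_steps : all (mem [:: south; east]) ending;
  se_stair_end :
    path_vertex nw_corner ending n
    = path_vertex 0 starting n + (se_length%:Z, se_length%:Z);
  ending_strictly_NE : forall i : nat, (0 < i < n)%N ->
    (path_vertex 0 starting i).1 < (path_vertex nw_corner ending i).1 /\
    (path_vertex 0 starting i).2 < (path_vertex nw_corner ending i).2;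
  shape_connected : forall c d : cells,
    connect (fun c' d' : cells => adjacent (val c') (val d')) c d;
  boundary : seq edge :=
    path_edges 0 starting ++ path_edges 0 (NW_stair nw_length) ++
    path_edges nw_corner ending ++
    path_edges (path_vertex 0 starting n) (SE_stair se_length);
  horizontal_boundary : forall c : cell,
    (south_side c \in boundary) = ((c \in cells) != (c + south \in cells));
  vertical_boundary : forall c : cell,
    (west_side c \in boundary) = ((c \in cells) != (c + west \in cells))
}.

Inductive tile := Cross | Contact.

Definition filling n (F : alternating_shape n) : Type := {ffun cells F -> tile}.

Section Pipes.
Variables (n : nat) (F : alternating_shape n).
Implicit Types (P Q : filling F) (w p : 'S_n) (a b i : 'I_n) (c d : cells F).

Definition entry_edge i : edge := path_edge 0 (starting F) i.
Definition exit_edge i : edge := path_edge (nw_corner F) (ending F) i.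

(* The edge through which a pipe leaves the cell that it enters through the
   edge e (necessarily its west or south side); a pipe stops when it leaves F. *)
Definition advance P (e : edge) : edge :=
  if insub e.2 is Some c then
    match e.1, P c with
    | true, Cross => north_side (val c)
    | true, Contact => east_side (val c)
    | false, Cross => east_side (val c)
    | false, Contact => north_side (val c)
    end
  else e.

(* Pipe labels are 0, ..., n-1 rather than 1, ..., n. *)
Definition passes P a (e : edge) : Prop :=
  exists k : nat, iter k (advance P) (entry_edge a) = e.

Definition crossing P a b c : Prop :=
  P c = Cross /\
  ((passes P a (west_side (val c)) /\ passes P b (south_side (val c))) \/
   (passes P b (west_side (val c)) /\ passes P a (south_side (val c)))).

Definition reduced P : Prop :=
  forall a b, a != b ->
  forall c d, crossing P a b c -> crossing P a b d -> c = d.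

Definition exit_permutation P w : Prop :=
  forall i, passes P (w i) (exit_edge i).

Definition reduced_pipe_dream w P : Prop := exit_permutation P w /\ reduced P.

Definition sortable w : Prop := exists P, reduced_pipe_dream w P.

Definition inversion w a b : bool :=
  ((a < b) && ((w^-1)%g b < (w^-1)%g a))%N.

Definition noninversion w a b : bool := (a < b)%N && ~~ inversion w a b.

Definition weak_le w p : Prop :=
  forall a b, inversion w a b -> inversion p a b.

(* On the stairs, one of the two elbows of a contact carries no pipe, and the
   contact gives no arc. *)
Definition contact_arc P a b : Prop :=
  exists c, [/\ P c = Contact, passes P a (west_side (val c))
              & passes P b (south_side (val c))].

Definition extended_arc w P a b : Prop :=
  contact_arc P a b \/ noninversion w a b.

Definition acyclic (T : Type) (R : relation T) : Prop :=
  forall x : T, ~ clos_trans T R x x.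

Definition strongly_acyclic_pipe_dream w P : Prop :=
  reduced_pipe_dream w P /\ acyclic (extended_arc w P).

Definition lin w P p : Prop :=
  forall a b, extended_arc w P a b -> ((p^-1)%g a < (p^-1)%g b)%N.

Definition acyclic_le w P Q : Prop :=
  exists p q : 'S_n, [/\ lin w P p, lin w Q q & weak_le p q].

End Pipes.

Section Lattice.
Variables (T : Type) (A : T -> Prop) (le : T -> T -> Prop).

Definition partial_order_on : Prop :=
  [/\ forall x, A x -> le x x,
      forall x y, A x -> A y -> le x y -> le y x -> x = y
    & forall x y z, A x -> A y -> A z -> le x y -> le y z -> le x z].

Definition is_meet (x y m : T) : Prop :=
  [/\ A m, le m x, le m y & forall z, A z -> le z x -> le z y -> le z m].

Definition is_join (x y j : T) : Prop :=
  [/\ A j, le x j, le y j & forall z, A z -> le x z -> le y z -> le j z].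

Definition lattice_on : Prop :=
  partial_order_on /\
  forall x y, A x -> A y -> (exists m, is_meet x y m) /\ (exists j, is_join x y j).

End Lattice.

(* Main.v *)
(** Let [f] send a permutation [pi] below [w] in the weak order to the pipe dream
  whose extended contact graph is compatible with [pi].  It exists because
  exchanging a contact violating [pi] with the crossing of the same two pipes
  increases a linear functional (the one of the brick polytope); it is unique
  because descending one step in the weak order either keeps the pipe dream or
  exchanges a crossing with the last contact of the two pipes, an invertible move,
  and because at the identity a pipe dream can be read backwards from its exits.
  So the sets [lin P] partition the weak order interval below [w].

  Contract the cover relations of this interval whose ends have the same image.
  Squares and hexagons show that contraction downwards is confluent and that normal
  forms are monotone, the geometric input being that the permutation [... z y x ...]
  with [x < y < z] forbids contacts from [z] to [x]: the third pipe [y] has to leave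
  the zone between [z] and [x], and looking for elbows inside the rectangle spanned
  by the last elbows before its exit gives a contact path contradicting the order.
  This rectangle stays inside the shape because the shape is alternating.
  Hence [P <= Q] in the acyclic order iff the normal form of [lin P] is below that of
  [lin Q] in the weak order, and joins and meets are the images of those of the
  normal forms. *)

Require Import Defs.
From Stdlib Require Import Classical ClassicalEpsilon Relation_Operators.
From mathcomp Require Import all_boot all_order all_algebra all_fingroup finmap zify.

Set Implicit Arguments.
Unset Strict Implicit.
Unset Printing Implicit Defensive.

(** * The weak order *)

(** Only downward contractions occur, because the minima of the classes suffice on both sides. If
    [d] and [e] are the minima of two classes, the class of their weak meet lies below both, and the
    minimum of any common lower bound lies below [d] and [e], hence below their meet; joins are
    treated in the same way. Maxima of classes never enter. The obstacle is the hexagon. A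
    contraction at its top continues one edge further down exactly when no contact goes from [z] to
    [x]. Once this is known, the other side of the hexagon contracts below its first edge, since a
    flip is determined by the pipe dream and the pair of pipes, whatever the permutation at which it
    is made. The geometry serves to exclude that contact; the alternating shape enters there through
    the fact that [lo] and [hi] change by one between consecutive diagonals. *)

Section WeakOrder.
Variable n : nat.
Implicit Types (a b c x y z : 'I_n) (r s u v : 'S_n).

(** Permutations are stored as ranks: [r a] is the position of the label [a], so [r] is the inverse
    of the one-line notation, and [tperm x y * r] exchanges the labels [x] and [y]. *)
Definition inversions r : {set 'I_n * 'I_n} :=
  [set ab : 'I_n * 'I_n | (ab.1 < ab.2)%N && (r ab.2 < r ab.1)%N].

Definition wle r v : bool := inversions r \subset inversions v.

Lemma wleP r v :
  reflect (forall a b, (a < b)%N -> (r b < r a)%N -> (v b < v a)%N) (wle r v).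
Proof.
apply: (iffP subsetP) => [h a b ab rab|h [a b]].
  by have := h (a, b); rewrite !inE /= ab rab => /(_ isT).
by rewrite !inE /= => /andP[ab rab]; rewrite ab h.
Qed.

Lemma rank_neq r a b : a <> b -> r a <> r b :> nat.
Proof. by move=> ab /val_inj/perm_inj. Qed.

Section AdjacentSwap.
Variables (r : 'S_n) (x y : 'I_n).
Hypothesis adj : r x = (r y).+1 :> nat.

Lemma swap_rank_lt a b : ~ (a = x /\ b = y) -> ~ (a = y /\ b = x) ->
  ((tperm x y * r)%g a < (tperm x y * r)%g b)%N = (r a < r b)%N.
Proof.
have far c : c <> x -> c <> y -> r c <> r x :> nat /\ r c <> r y :> nat.
  by move=> cx cy; split; apply: rank_neq.
have key (p q s : nat) : p = q.+1 -> s <> p /\ s <> q ->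
    ((q < s) = (p < s))%N /\ ((s < q) = (s < p))%N by lia.
move=> nxy nyx; rewrite !permM.
case: (tpermP x y a) => [ea|ea|ax ay]; case: (tpermP x y b) => [eb|eb|bx b_y].
- by rewrite ea eb !ltnn.
- by case: nxy.
- by rewrite ea (key _ _ _ adj (far b bx b_y)).1.
- by case: nyx.
- by rewrite ea eb !ltnn.
- by rewrite ea (key _ _ _ adj (far b bx b_y)).1.
- by rewrite eb (key _ _ _ adj (far a ax ay)).2.
- by rewrite eb (key _ _ _ adj (far a ax ay)).2.
by [].
Qed.

Lemma swap_rank_xy : ((tperm x y * r)%g x < (tperm x y * r)%g y)%N.
Proof. by rewrite !permM tpermL tpermR adj. Qed.

Lemma inversions_swap : (x < y)%N ->
  inversions (tperm x y * r)%g = inversions r :\ (x, y).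
Proof.
move=> xy; apply/setP => -[a b]; rewrite !inE /=.
have [[-> ->] /=|] := eqVneq (a, b) (x, y).
  by apply/negbTE; rewrite negb_and -!leqNgt (ltnW swap_rank_xy) orbT.
rewrite xpair_eqE => nab /=; case ab: (a < b)%N => //=.
apply: swap_rank_lt => -[? ?]; subst; first lia.
by move: nab; rewrite !eqxx.
Qed.

Lemma swap_wle : (x < y)%N -> wle (tperm x y * r)%g r.
Proof. by move=> xy; rewrite /wle inversions_swap // subsetDl. Qed.

Lemma card_inversions_swap : (x < y)%N ->
  (#|inversions (tperm x y * r)%g| < #|inversions r|)%N.
Proof.
move=> xy; rewrite inversions_swap // [X in (_ < X)%N](cardsD1 (x, y)).
by rewrite inE /= xy adj ltnSn.
Qed.

Lemma wle_swap s : (x < y)%N -> wle s r -> (s x < s y)%N -> wle s (tperm x y * r)%g.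
Proof.
move=> xy sr sxy; rewrite /wle inversions_swap // subsetD1 -/(wle s r) sr inE /=.
by rewrite xy /= -leqNgt ltnW.
Qed.
End AdjacentSwap.

Lemma increasing_perm1 r : (forall a b, (a < b)%N -> (r a < r b)%N) -> r = 1%g.
Proof.
have low (s : 'S_n) : (forall a b, (a < b)%N -> (s a < s b)%N) -> forall a, (a <= s a)%N.
  move=> inc a; have [k ak] : exists k, a = k :> nat by exists a.
  elim: k a ak => [|k IH] a ak; first by rewrite ak.
  have kn : (k < n)%N by have := ltn_ord a; lia.
  have := IH (Ordinal kn) erefl; have := inc (Ordinal kn) a; rewrite /= ak leqnn.
  by move=> /(_ isT); lia.
move=> inc; apply/permP => a; apply/val_inj/anti_leq; rewrite perm1 /=.
have invinc b c : (b < c)%N -> ((r^-1)%g b < (r^-1)%g c)%N.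
  move=> bc; case: (ltngtP ((r^-1)%g b) ((r^-1)%g c)) => // [/inc|/val_inj/perm_inj e].
    by rewrite !permKV; lia.
  by rewrite e ltnn in bc.
by have := low _ invinc (r a); rewrite permK => ->; rewrite low.
Qed.

(** Chaining labels that are consecutive for [s] makes [s^-1 * r] increasing, hence the identity. *)
Lemma perm_eq_adjacent r s :
  (forall a b, s b = (s a).+1 :> nat -> (r a < r b)%N) -> r = s.
Proof.
move=> inc1.
have inc d : forall a b, s b = s a + d.+1 :> nat -> (r a < r b)%N.
  elim: d => [|d IH] a b ab; first by apply: inc1; lia.
  have bn : ((s b).-1 < n)%N by have := ltn_ord (s b); lia.
  have hc : s ((s^-1)%g (Ordinal bn)) = (s b).-1 :> nat by rewrite permKV.
  apply: (@ltn_trans (r ((s^-1)%g (Ordinal bn)))).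
    by apply: IH; rewrite hc; lia.
  by apply: inc1; rewrite hc; lia.
have : (s^-1 * r = 1)%g.
  apply: increasing_perm1 => a b ab; rewrite !permM.
  by apply: (inc (b - a).-1); rewrite !permKV; lia.
by move/(canRL (mulKVg _)); rewrite mulg1.
Qed.

(** Some pair consecutive for [s] is ordered differently by [r]. Since inversions of [r] are
    inversions of [s], this pair can only be an inversion of [s]. *)
Lemma exists_descent r s : wle r s -> r <> s ->
  exists x y, [/\ (x < y)%N, s x = (s y).+1 :> nat & (r x < r y)%N].
Proof.
move=> /wleP rs nrs; apply: NNPP => none; apply: nrs.
apply: perm_eq_adjacent => a b ab.
case: (ltngtP (r a) (r b)) => // [rba|/val_inj/perm_inj e]; last first.
  by move: ab; rewrite e; lia.
case: (ltngtP a b) => [lab|lba|/val_inj e].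
- by have := rs _ _ lab rba; lia.
- by case: none; exists b, a.
by move: rba; rewrite e ltnn.
Qed.

Lemma wle_refl r : wle r r.
Proof. exact: subxx. Qed.

Lemma wle_trans s r u : wle r s -> wle s u -> wle r u.
Proof. exact: subset_trans. Qed.

Lemma wle_antisym r s : wle r s -> wle s r -> r = s.
Proof.
move=> rs /wleP sr; apply: NNPP => /(exists_descent rs) [x [y [xy adj rxy]]].
by have := sr x y xy; lia.
Qed.

Lemma perm_of_order (lt : rel 'I_n) : irreflexive lt -> transitive lt ->
  (forall a b, a != b -> lt a b || lt b a) ->
  exists r : 'S_n, forall a b, lt a b = (r a < r b)%N.
Proof.
move=> irr tr tot.
pose below a := [set b | lt b a].
have bn a : (#|below a| < n)%N.
  rewrite -[X in (_ < X)%N](card_ord n) -cardsT; apply: proper_card.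
  by rewrite properEneq subsetT andbT; apply/eqP => /setP/(_ a); rewrite !inE irr.
have lt_below a b : lt a b -> (#|below a| < #|below b|)%N.
  move=> ab; apply: proper_card; apply/properP; split.
    by apply/subsetP => c; rewrite !inE => /tr; apply.
  by exists a; rewrite !inE ?irr.
pose f a := Ordinal (bn a).
have f_inj : injective f.
  by move=> a b /(congr1 val) /= fab; apply/eqP; apply: contraT => /tot/orP[]/lt_below; rewrite fab ltnn.
exists (perm f_inj) => a b; rewrite !permE /=.
apply/idP/idP => [/lt_below //|fab].
have ab : a != b by apply/eqP => e; rewrite e ltnn in fab.
by case/orP: (tot _ _ ab) => // /lt_below /(ltn_trans fab); rewrite ltnn.
Qed.

(* The inversions of the join are the transitive closure of the union of the
   inversions: a closure step from [c] down to [a] jumping over [b] splits at [b]. *)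
Lemma weak_join (S : {set 'S_n}) : exists j, (forall r, r \in S -> wle r j) /\
  (forall u, (forall r, r \in S -> wle r u) -> wle j u).
Proof.
pose e : rel 'I_n := fun b a => (a < b)%N && [exists r in S, (r b < r a)%N].
pose con := connect e.
have con_le b a : con b a -> (a <= b)%N.
  case/connectP=> p; elim: p b => [|c p IH] b /=; first by move=> _ ->.
  by move=> /andP[/andP[cb _] pp] /(IH _ pp); lia.
have con_split a b c : (a < b)%N -> (b < c)%N -> con c a -> con c b || con b a.
  move=> ab bc /connectP[p]; elim: p c bc => [|d p IH] c bc /=.
    by move=> _ e'; move: ab bc; rewrite e'; lia.
  move=> /andP[ecd pp] ea; have [/andP[dc /exists_inP[r rS rcd]]] := ecd.
  have conda : con d a by apply/connectP; exists p.
  case: (ltngtP b d) => [bd|db|/val_inj ->]; last first.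
  - by rewrite conda orbT.
  - have : (r c < r b)%N || (r b < r d)%N by lia.
    case/orP=> [rcb|rbd].
      by rewrite (_ : con c b) //; apply: connect1; rewrite /e bc; apply/exists_inP; exists r.
    rewrite (_ : con b a) ?orbT //; apply: connect_trans conda; apply: connect1.
    by rewrite /e db; apply/exists_inP; exists r.
  - have := IH d bd pp ea; case/orP=> [db|->]; last by rewrite orbT.
    by rewrite (_ : con c b) //; apply: connect_trans db; apply: connect1.
(* The join inverts exactly the pairs related by [con]; [con_split] makes the resulting order
   transitive. *)
pose lt a b := if (a < b)%N then ~~ con b a else (b < a)%N && con a b.
have [||| j jE] := perm_of_order (lt := lt).
- by move=> a; rewrite /lt ltnn.
- move=> b a c; rewrite /lt.
  have tr x y z : con x y -> con y z -> con x z by apply: connect_trans.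
  case: (ltngtP a b) => [ab|ba|/val_inj ->]; rewrite ?ltnn //=.
    case: (ltngtP b c) => [bc|cb|/val_inj ->]; rewrite ?ltnn //=.
      rewrite (ltn_trans ab bc) => nba ncb; apply/negP => /(con_split _ _ _ ab bc).
      by rewrite (negPf nba) (negPf ncb).
    move=> nba cbc; case: (ltngtP a c) => [ac|ca|/val_inj e'] /=.
    - by apply: contra nba => cca; apply: tr cbc cca.
    - by have := con_split _ _ _ ca ab cbc; rewrite (negPf nba).
    by move: cbc; rewrite -e' (negPf nba).
  case: (ltngtP b c) => [bc|cb|/val_inj ->]; rewrite ?ltnn //=.
    move=> cab ncb; case: (ltngtP a c) => [ac|ca|/val_inj e'] /=.
    - by apply: contra ncb => cca; apply: tr cca cab.
    - by have := con_split _ _ _ bc ca cab; rewrite (negPf ncb) orbF.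
    by move: ncb; rewrite -e' cab.
  by move=> cab cbc; rewrite ltnNge (ltnW (ltn_trans cb ba)) (ltn_trans cb ba) /=; apply: tr cab cbc.
- move=> a b nab; rewrite /lt; case: (ltngtP a b) => [ab|ba|/val_inj e'] /=.
  + by case: (con b a).
  + by case: (con a b).
  by rewrite e' eqxx in nab.
exists j; split=> [r rS|u Su].
  apply/wleP => a b ab rba; rewrite -jE /lt ltnNge (ltnW ab) ab /=.
  by apply: connect1; rewrite /e ab; apply/exists_inP; exists r.
apply/wleP => a b ab; rewrite -jE /lt ltnNge (ltnW ab) ab /= => /connectP[p].
elim: p b ab => [|c p IH] b ab /=; first by move=> _ e'; move: ab; rewrite e' ltnn.
move=> /andP[/andP[cb /exists_inP[r rS rbc]] pp] la.
have ubc : (u b < u c)%N by have /wleP := Su r rS; apply.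
have : con c a by apply/connectP; exists p.
move/con_le; rewrite leq_eqVlt => /orP[/eqP/val_inj -> //|ac].
exact: ltn_trans ubc (IH c ac pp la).
Qed.

(** The meet is the join of all common lower bounds, whence joins of sets rather than of pairs. *)
Lemma weak_meet r s : exists m, [/\ wle m r, wle m s &
  forall u, wle u r -> wle u s -> wle u m].
Proof.
have [m [hm least]] := weak_join [set u | wle u r && wle u s].
exists m; split=> [||u ur us]; last by apply: hm; rewrite inE ur us.
  by apply: least => u; rewrite inE => /andP[].
by apply: least => u; rewrite inE => /andP[].
Qed.

(** Labels are sorted by their number of predecessors in the transitive closure, with ties broken by
    the label itself. *)
Lemma topological_sort (R : 'I_n -> 'I_n -> Prop) :
  (forall a, ~ clos_trans _ R a a) ->
  exists r : 'S_n, forall a b, R a b -> (r a < r b)%N.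
Proof.
move=> acy.
have dec a b : {clos_trans _ R a b} + {~ clos_trans _ R a b}.
  exact: excluded_middle_informative.
pose le a b : bool := dec a b.
have leP a b : reflect (clos_trans _ R a b) (le a b) by apply: sumboolP.
pose h a := #|[set b | le b a]|.
have h_lt a b : R a b -> (h a < h b)%N.
  move=> ab; apply: proper_card; apply/properP; split.
    apply/subsetP => c; rewrite !inE => /leP ca; apply/leP.
    by apply: t_trans ca _; apply: t_step.
  exists a; rewrite !inE; first by apply/leP/t_step.
  by apply/negP => /leP; apply: acy.
pose lt a b := (h a < h b)%N || (h a == h b) && (a < b)%N.
have [||| r rE] := perm_of_order (lt := lt).
- by move=> a; rewrite /lt; lia.
- by move=> b a c; rewrite /lt; lia.
- move=> a b ab; have : a <> b :> nat by move/val_inj => e; rewrite e eqxx in ab.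
  by rewrite /lt; lia.
by exists r => a b ab; rewrite -rE /lt h_lt.
Qed.

End WeakOrder.

(** * Brick-wall networks *)

(* The cell [(t, i)] is the one on the anti-diagonal [t] and the diagonal [i] of the
   grid.  A pipe is located by the strip between two consecutive diagonals, numbered
   from 0; the west and north sides of the cell [(t, i)] are on the strip [i.-1] and
   its south and east sides on the strip [i], so a cross exchanges these two strips
   and a contact is the identity.  This makes sense for all times: outside of the
   shape, pipes are extended by contacts, so that they stay on their strip.  A
   filling is given by the set [X] of its crosses. *)
Section Network.
Variables (n T : nat) (lo hi : nat -> nat).
Hypothesis lo_step : forall i, (i < n)%N -> lo i.+1 = (lo i).+1 \/ lo i = (lo i.+1).+1.
Hypothesis hi_step : forall i, (i < n)%N -> hi i.+1 = (hi i).+1 \/ hi i = (hi i.+1).+1.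
Hypothesis lo_gt0 : forall i, (i <= n)%N -> (0 < lo i)%N.
Hypothesis hi_le : forall i, (i <= n)%N -> (hi i <= T)%N.

Implicit Types (X Y : nat -> nat -> bool) (a b c p q x y z : 'I_n) (r s v : 'S_n).

Definition in_region (t i : nat) : bool :=
  [&& (i <= n)%N, (lo i <= t < hi i)%N & ~~ odd (t + i)].

Definition step X t (j : nat) : nat :=
  if X t j then j.-1 else if X t j.+1 then j.+1 else j.

Fixpoint pos X t (a : nat) : nat := if t is t'.+1 then step X t' (pos X t' a) else a.

(** Crosses are excluded on the extreme diagonals [0] and [n], which are adjacent to a single
    strip. *)
Definition fits X := forall t i, X t i -> (0 < i < n)%N /\ in_region t i.

Lemma fits_parity X t i : fits X -> X t i -> ~~ odd (t + i).
Proof. by move=> fX /fX[_ /and3P[]]. Qed.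

Lemma fits_succ X t i : fits X -> X t i -> X t i.+1 = false.
Proof.
move=> fX /(fits_parity fX) h; apply/negP => /(fits_parity fX) h'; lia.
Qed.

(** Crosses of one anti-diagonal have diagonals of equal parity, so [step] is a product of disjoint
    transpositions. *)
Lemma stepK X t : fits X -> involutive (step X t).
Proof.
move=> fX j; rewrite {2}/step; case: ifP => [Xj|Xj].
  have [j_gt0 _] := fX _ _ Xj.
  have jE : j.-1.+1 = j by lia.
  rewrite /step jE Xj; case: ifP => [Xj1|//].
  by move: (fits_succ fX Xj1); rewrite jE Xj.
by case: ifP => Xj1; rewrite /step ?Xj1 ?Xj.
Qed.

Lemma step_lt X t j : fits X -> (j < n)%N -> (step X t j < n)%N.
Proof.
move=> fX jn; rewrite /step; case: ifP => [/fX[+ _]|_]; first lia.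
by case: ifP => [/fX[+ _]|_] //; lia.
Qed.

Lemma pos_lt X t a : fits X -> (pos X t a < n)%N.
Proof. by move=> fX; elim: t => //= t IH; apply: step_lt. Qed.

Lemma pos_inj X t : fits X -> injective (pos X t).
Proof.
move=> fX; elim: t => [|t IH] a b //= /(can_inj (stepK t fX)); exact: IH.
Qed.

Lemma pos_eq X t a b : fits X -> pos X t a = pos X t b -> a = b.
Proof. by move=> fX /(pos_inj fX)/val_inj. Qed.

Lemma pos_surj X t j : fits X -> (j < n)%N -> exists a : 'I_n, pos X t a = j.
Proof.
move=> fX jn.
pose f a := Ordinal (pos_lt t a fX).
have f_inj : injective f by move=> a b /(congr1 val)/= /(pos_eq fX).
have [g fK gK] := injF_bij f_inj.
by exists (g (Ordinal jn)); have /(congr1 val) := gK (Ordinal jn).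
Qed.

Lemma pos_pred X t a : fits X -> pos X t a = step X t (pos X t.+1 a).
Proof. by move=> fX /=; rewrite stepK. Qed.

(* [a] comes from the west and [b] from the south. *)
Definition enters X (t i a b : nat) : Prop := (pos X t a).+1 = i /\ pos X t b = i.

Definition arc X a b : Prop :=
  exists t i, [/\ in_region t i, X t i = false & enters X t i a b].

(** This is reducedness: pipes start in the order of their labels, so crossing at most once means
    that an inversion, once created, persists. *)
Definition monotone X : Prop := forall a b t t', (a < b)%N -> (t <= t')%N ->
  (pos X t b < pos X t a)%N -> (pos X t' b < pos X t' a)%N.

(** [v] sends a pipe to its exit step; it is the inverse of the exit permutation. *)
Record good X v : Prop := Good {
  good_fits : fits X;
  good_mono : monotone X;
  good_exit : forall a, pos X T a = v a }.

(** These are the ranks of the linear extensions of the extended contact graph; the second clause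
    accounts for the noninversions. *)
Definition compatible X v r : Prop :=
  (forall a b, arc X a b -> (r a < r b)%N) /\
  (forall a b, (a < b)%N -> (v a < v b)%N -> (r a < r b)%N).

Lemma step_cross X t i : fits X -> X t i -> step X t i = i.-1 /\ step X t i.-1 = i.
Proof.
move=> fX Xi; have [i0 _] := fX _ _ Xi; split; first by rewrite /step Xi.
have iE : i.-1.+1 = i by lia.
rewrite /step iE Xi; case: ifP => // Xp.
by move: (fits_succ fX Xp); rewrite iE Xi.
Qed.

Lemma step_contact X t i : fits X -> ~~ odd (t + i) -> X t i = false ->
  step X t i = i /\ step X t i.-1 = i.-1.
Proof.
move=> fX ti Xi.
have odd_off k : odd (t + k) -> X t k = false.
  by move=> h; apply/negP => /(fits_parity fX); rewrite h.
split; first by rewrite /step Xi odd_off //; lia.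
case: i ti Xi => [|i] ti Xi; rewrite /step /= ?Xi odd_off //; lia.
Qed.

Lemma order_step X t a b : fits X -> (pos X t a < pos X t b)%N ->
  (pos X t.+1 b < pos X t.+1 a)%N ->
  exists i, X t i /\ enters X t i a b.
Proof.
move=> fX /= hlt; rewrite /step.
case: ifP => Xb; last by do ?[case: ifP => ?]; move=> ?; exfalso; lia.
do ?[case: ifP => ?]; move=> ?; try (exfalso; lia).
by exists (pos X t b); split=> //; split=> //; lia.
Qed.

Lemma order_change X t t' a b : fits X -> (t <= t')%N -> (pos X t a < pos X t b)%N ->
  (pos X t' b < pos X t' a)%N ->
  exists u i, [/\ (t <= u < t')%N, X u i & enters X u i a b].
Proof.
move=> fX; elim: t' => [|t' IH]; first by rewrite leqn0 => /eqP-> ? ?; lia.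
rewrite leq_eqVlt => /orP[/eqP<- ? ?|tt' h h']; first lia.
have [h2|h2] := ltnP (pos X t' b) (pos X t' a).
  have [u [i [? ? ?]]] := IH tt' h h2; exists u, i; split=> //; lia.
have h3 : (pos X t' a < pos X t' b)%N.
  rewrite ltn_neqAle h2 andbT; apply/eqP => /(pos_eq fX) ab.
  by rewrite ab ltnn in h'.
have [i [? ?]] := order_step fX h3 h'.
by exists t', i; split=> //; lia.
Qed.

Definition meets X t i x y : Prop := enters X t i x y \/ enters X t i y x.

Lemma step_toggle X Y t i x y z : fits X -> ~~ odd (t + i) ->
  (forall k, Y t k = X t k (+) (k == i)) -> meets X t i x y ->
  step Y t (pos X t z) = step X t (pos X t (tperm x y z)).
Proof.
move=> fX ti YE.
wlog [xi yi] : x y / enters X t i x y.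
  move=> hw [h|h]; first by apply: hw => //; left.
  by rewrite tpermC; apply: hw => //; left.
have odd_off k : odd (t + k) -> X t k = false.
  by move=> h; apply/negP => /(fits_parity fX); rewrite h.
have Xi1 : X t i.+1 = false by apply: odd_off; lia.
have Xi2 : X t i.-1 = false by apply: odd_off; lia.
have xi' : pos X t x = i.-1 by lia.
have i0 : i.-1.+1 = i by lia.
move=> _; case: tpermP => [->|->|zx zy].
- rewrite yi xi' /step !YE i0 Xi1 Xi2 eqxx.
  have -> : (i.-1 == i) = false by lia.
  by case: (X t i).
- rewrite yi xi' /step !YE i0 Xi1 Xi2 eqxx.
  have -> : (i.+1 == i) = false by lia.
  by case: (X t i).
have zi : (pos X t z == i) = false.
  by apply/eqP; rewrite -yi => /(pos_eq fX).
have zi1 : ((pos X t z).+1 == i) = false.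
  by apply/eqP; rewrite -xi => -[] /(pos_eq fX).
by rewrite /step !YE zi zi1 !addbF.
Qed.

Lemma meets_inner X t i x y : fits X -> meets X t i x y -> (0 < i < n)%N.
Proof.
by move=> fX [] [h1 h2]; have := pos_lt t x fX; have := pos_lt t y fX; lia.
Qed.

(** [x] and [y] occupy neighbouring strips, so no third pipe lies between them. *)
Lemma meets_order X t i x y z : fits X -> z != x -> z != y -> meets X t i x y ->
  (pos X t z < pos X t x)%N = (pos X t z < pos X t y)%N.
Proof.
move=> fX /eqP zx /eqP zy h.
have nx : pos X t z <> pos X t x by move/(pos_eq fX).
have ny : pos X t z <> pos X t y by move/(pos_eq fX).
by case: h => -[]; lia.
Qed.

Lemma cross_order X t i x y : fits X -> monotone X -> (x < y)%N -> X t i -> meets X t i x y ->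
  enters X t i x y /\ (pos X t.+1 y < pos X t.+1 x)%N.
Proof.
move=> fX monoX xy Xi m.
have [s1 s2] := step_cross fX Xi.
have i0 := meets_inner fX m.
case: m => -[h1 h2].
  by split=> //; rewrite /= h2 s1 (_ : pos X t x = i.-1) ?s2; lia.
have : (pos X t.+1 y < pos X t.+1 x)%N.
  by apply: (monoX _ _ _ _ xy (leqnSn t)); lia.
by rewrite /= h2 s1 (_ : pos X t y = i.-1) ?s2; lia.
Qed.

(** * Exchanging a contact and a crossing *)

Definition toggle X tA iA tB iB t i : bool :=
  X t i (+) ((t == tA) && (i == iA) || (t == tB) && (i == iB)).

(** The interval is open at [tA] and closed at [tB] because a position at time [t] is taken before
    the tiles of time [t] act. *)
Definition swap_between tA tB x y t z : 'I_n :=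
  if (tA < t <= tB)%N then tperm x y z else z.

(* Two monotone functions agreeing at [tA] and [tB] may be exchanged between
   them; if [g] is antitone, the agreement makes both constant there. *)
Lemma splice_mono (f g : nat -> bool) tA tB : (tA < tB)%N ->
  f tA = g tA -> f tB = g tB ->
  (forall t t', (t <= t')%N -> f t -> f t') ->
  (forall t t', (t <= t')%N -> g t -> g t') \/ (forall t t', (t <= t')%N -> g t' -> g t) ->
  forall t t', (t <= t')%N ->
    (if (tA < t <= tB)%N then g t else f t) -> (if (tA < t' <= tB)%N then g t' else f t').
Proof.
move=> tAB fgA fgB fm gm t t' tt'.
have fAB := fm _ _ (ltnW tAB).
case: ifP => ht; case: ifP => ht'.
- case: gm => [gm|gm]; first exact: gm.
  move=> gt; apply: (gm t' tB); first lia.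
  by rewrite -fgB fAB // fgA (gm tA t) //; lia.
- case: gm => [gm|gm] gt.
    by apply: (fm tB); [lia | rewrite fgB (gm t) //; lia].
  by apply: (fm tA); [lia | rewrite fgA (gm tA t) //; lia].
- case: gm => [gm|gm] ft.
    by apply: (gm tA); [lia | rewrite -fgA (fm t) //; lia].
  by apply: (gm t' tB); [lia | rewrite -fgB (fm t) //; lia].
exact: fm.
Qed.

Section Toggle.
Variables (X : nat -> nat -> bool) (tA iA tB iB : nat) (x y : 'I_n).
Hypotheses (fX : fits X) (FA : in_region tA iA) (FB : in_region tB iB).
Hypotheses (tAB : (tA < tB)%N) (mA : meets X tA iA x y) (mB : meets X tB iB x y).
Let X' := toggle X tA iA tB iB.
Let sw := swap_between tA tB x y.

Lemma toggle_fits : fits X'.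
Proof.
move=> t i; rewrite /X' /toggle.
have [/andP[/eqP-> /eqP->] _|_] := boolP ((t == tA) && (i == iA)).
  by split=> //; apply: (meets_inner fX mA).
have [/andP[/eqP-> /eqP->] _|_] := boolP ((t == tB) && (i == iB)).
  by split=> //; apply: (meets_inner fX mB).
by rewrite addbF => /fX.
Qed.

Lemma pos_toggle t z : pos X' t z = pos X t (sw t z).
Proof.
elim: t => [|t IH] /=; first by rewrite /sw /swap_between ltn0.
rewrite IH /sw /swap_between.
have [-> {t IH}|tA'] := eqVneq t tA.
  rewrite !ltnn tAB ltnSn /=; apply: (@step_toggle _ _ _ iA) => //.
    by case/and3P: FA.
  by move=> k; rewrite /X' /toggle eqxx (ltn_eqF tAB) /= orbF.
have [-> {t IH tA'}|tB'] := eqVneq t tB.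
  rewrite tAB leqnn ltnn andbF -[in RHS](tpermK x y z).
  apply: (@step_toggle _ _ _ iB) => //.
    by case/and3P: FB.
  by move=> k; rewrite /X' /toggle eqxx (gtn_eqF tAB).
have -> : (tA < t.+1 <= tB)%N = (tA < t <= tB)%N by lia.
by rewrite /step /X' /toggle (negPf tA') (negPf tB') !addbF.
Qed.

Hypotheses (xy : (x < y)%N) (monoX : monotone X).
Hypothesis one_cross : X tA iA (+) X tB iB.

(** [x] and [y] cross only once, at whichever of the two tiles is a cross, so this tile decides
    their order in between. *)
Lemma order_between t : (pos X t y < pos X t x)%N =
  if (t <= tA)%N then false else if (tB < t)%N then true else X tA iA.
Proof.
have posN u : pos X u x <> pos X u y by move=> /(pos_eq fX) h; move: xy; rewrite h ltnn.
have early u : (pos X u x < pos X u y)%N -> (t <= u)%N -> (pos X t y < pos X t x)%N = false.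
  by move=> h tu; apply/negP => /(monoX xy tu); lia.
have late u : (pos X u y < pos X u x)%N -> (u <= t)%N -> (pos X t y < pos X t x)%N.
  by move=> h tu; apply: (monoX xy tu).
move: one_cross; case: (boolP (X tA iA)) => XA /=.
  move=> _; have [[? ?] oA] := cross_order fX monoX xy XA mA.
  case: (leqP t tA) => tA'; first by apply: (early tA) => //; lia.
  by rewrite (late tA.+1) //; case: ifP.
move=> XB; have [[? ?] oB] := cross_order fX monoX xy XB mB.
case: (leqP t tA) => tA'; first by apply: (early tB) => //; lia.
case: (ltnP tB t) => tB'; first by rewrite (late tB.+1).
by apply: (early tB) => //; lia.
Qed.

(** For [x] and [y] themselves, the toggle moves their unique crossing to the other tile. For a
    third pipe, the comparisons with [x] and with [y] agree at both tiles, and [splice_mono] allows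
    exchanging them in between. *)
Lemma toggle_monotone : monotone X'.
Proof.
move=> a b t t' ab tt'; rewrite !pos_toggle.
have swN u z : z != x -> z != y -> sw u z = z.
  by move=> zx zy; rewrite /sw /swap_between tpermD 1?eq_sym // if_same.
have swx u : sw u x = if (tA < u <= tB)%N then y else x.
  by rewrite /sw /swap_between tpermL.
have swy u : sw u y = if (tA < u <= tB)%N then x else y.
  by rewrite /sw /swap_between tpermR.
have posN u p q : p != q -> pos X u p <> pos X u q.
  by move=> /eqP pq /(pos_eq fX).
have mono2 p q : p != q ->
    (forall u u', (u <= u')%N -> (pos X u q < pos X u p)%N -> (pos X u' q < pos X u' p)%N) \/
    (forall u u', (u <= u')%N -> (pos X u' q < pos X u' p)%N -> (pos X u q < pos X u p)%N).
  move=> pq; case: (ltngtP p q) => [lpq|lqp|/val_inj/eqP]; last by rewrite (negPf pq).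
    by left=> u u'; apply: monoX.
  right=> u u' uu' h; have := monoX lqp uu'.
  by have := posN u p q pq; have := posN u' p q pq; lia.
have eqA z : z != x -> z != y -> (pos X tA z < pos X tA x)%N = (pos X tA z < pos X tA y)%N.
  by move=> zx zy; apply: meets_order fX _ _ mA.
have eqB z : z != x -> z != y -> (pos X tB z < pos X tB x)%N = (pos X tB z < pos X tB y)%N.
  by move=> zx zy; apply: meets_order fX _ _ mB.
have yx : y != x by apply/eqP => e; move: xy; rewrite e ltnn.
have flip u p q : p != q -> (pos X u p < pos X u q)%N = ~~ (pos X u q < pos X u p)%N.
  by move=> /(posN u); lia.
have [ax|nax] := eqVneq a x.
  have [bby|nby] := eqVneq b y.
    rewrite ax bby !swx !swy.
    have := order_between t; have := order_between t'.
    have := flip t x y; have := flip t' x y; rewrite eq_sym yx => /(_ isT) + /(_ isT).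
    by do !case: ifP => ?; lia.
  have nbx : b != x by rewrite -ax; apply/eqP => e; move: ab; rewrite e ltnn.
  rewrite (swN t b) // (swN t' b) // ax !swx.
  have := @splice_mono (fun u => pos X u b < pos X u x)%N (fun u => pos X u b < pos X u y)%N _ _
    tAB (eqA b nbx nby) (eqB b nbx nby) _ (mono2 _ _ _) t t' tt'.
  rewrite eq_sym nby => /(_ _ isT).
  have mx : forall u u', (u <= u')%N -> (pos X u b < pos X u x)%N -> (pos X u' b < pos X u' x)%N.
    by move=> u u'; apply: monoX; rewrite -ax.
  by move=> /(_ mx); do !case: ifP.
have [ay|nay] := eqVneq a y.
  have nbx : b != x by apply/eqP => e; move: ab xy; rewrite e ay; lia.
  have nby : b != y by rewrite -ay; apply/eqP => e; move: ab; rewrite e ltnn.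
  rewrite (swN t b) // (swN t' b) // ay !swy.
  have := @splice_mono (fun u => pos X u b < pos X u y)%N (fun u => pos X u b < pos X u x)%N _ _
    tAB (esym (eqA b nbx nby)) (esym (eqB b nbx nby)) _ (mono2 _ _ _) t t' tt'.
  rewrite eq_sym nbx => /(_ _ isT).
  have my : forall u u', (u <= u')%N -> (pos X u b < pos X u y)%N -> (pos X u' b < pos X u' y)%N.
    by move=> u u'; apply: monoX; rewrite -ay.
  by move=> /(_ my); do !case: ifP.
have eqA' : (pos X tA x < pos X tA a)%N = (pos X tA y < pos X tA a)%N.
  by rewrite !(flip _ _ a) 1?eq_sym // eqA.
have eqB' : (pos X tB x < pos X tB a)%N = (pos X tB y < pos X tB a)%N.
  by rewrite !(flip _ _ a) 1?eq_sym // eqB.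
rewrite (swN t a) // (swN t' a) //.
have [bx|nbx] := eqVneq b x.
  rewrite bx !swx.
  have := @splice_mono (fun u => pos X u x < pos X u a)%N (fun u => pos X u y < pos X u a)%N _ _
    tAB eqA' eqB' _ (mono2 _ _ nay) t t' tt'.
  have mx : forall u u', (u <= u')%N -> (pos X u x < pos X u a)%N -> (pos X u' x < pos X u' a)%N.
    by move=> u u'; apply: monoX; rewrite -bx.
  by move=> /(_ mx); do !case: ifP.
have [bby|nby] := eqVneq b y.
  rewrite bby !swy.
  have := @splice_mono (fun u => pos X u y < pos X u a)%N (fun u => pos X u x < pos X u a)%N _ _
    tAB (esym eqA') (esym eqB') _ (mono2 _ _ nax) t t' tt'.
  have my : forall u u', (u <= u')%N -> (pos X u y < pos X u a)%N -> (pos X u' y < pos X u' a)%N.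
    by move=> u u'; apply: monoX; rewrite -bby.
  by move=> /(_ my); do !case: ifP.
rewrite (swN t b) // (swN t' b) //.
exact: monoX.
Qed.
End Toggle.

Lemma swap_betweenC tA tB x y : swap_between tA tB x y =2 swap_between tA tB y x.
Proof. by move=> t z; rewrite /swap_between tpermC. Qed.

Lemma toggle_good X v tA iA tB iB x y : good X v ->
  in_region tA iA -> in_region tB iB -> (tA < tB)%N ->
  meets X tA iA x y -> meets X tB iB x y -> (x < y)%N -> X tA iA (+) X tB iB ->
  good (toggle X tA iA tB iB) v.
Proof.
move=> [fX mX eX] FA FB tAB mA mB xy one; split.

- exact: (toggle_fits fX FA FB mA mB).
- exact: (toggle_monotone fX FA FB tAB mA mB xy mX one).
move=> z; rewrite (pos_toggle fX FA FB tAB mA mB) /swap_between.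
case/and3P: FB => iBn /andP[_ tBhi] _.
have -> : (tA < T <= tB)%N = false by have := hi_le iBn; lia.
exact: eX.
Qed.

(* The linear functional of the brick polytope defined by the ranks [r]. *)
Definition potential r X := (\sum_(t < T) \sum_(a : 'I_n) pos X t a * r a)%N.

(** A rearrangement inequality at each time between the two tiles: the label of larger rank receives
    the larger strip. *)
Lemma potential_lt r X Y tA tB a b :
  (forall t z, pos Y t z = pos X t (swap_between tA tB a b t z)) ->
  (tA < tB < T)%N -> (r b < r a)%N ->
  (forall t, (tA < t <= tB)%N -> (pos X t a < pos X t b)%N) ->
  (potential r X < potential r Y)%N.
Proof.
move=> YE /andP[tAB tBT] rba hpos.
have ab : b != a by apply/eqP => e; rewrite e ltnn in rba.
have inside t : (tA < t <= tB)%N ->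
    (\sum_(z : 'I_n) pos X t z * r z < \sum_(z : 'I_n) pos Y t z * r z)%N.
  move=> ht; have hp := hpos t ht.
  rewrite (bigD1 a) // (bigD1 b) //= [X in (_ < X)%N](bigD1 a) // (bigD1 b) //=.
  rewrite !YE /swap_between ht tpermL tpermR.
  rewrite [X in (_ < _ + (_ + X))%N](eq_bigr (fun z => pos X t z * r z)%N); last first.
    by move=> z /andP[za zb]; rewrite YE /swap_between ht tpermD // eq_sym.
  move: hp rba; set p := pos X t a; set q := pos X t b; set u := nat_of_ord (r a).
  set w := nat_of_ord (r b); set S := bigop _ _ _ => hp hr.
  nia.
have weak t : (\sum_(z : 'I_n) pos X t z * r z <= \sum_(z : 'I_n) pos Y t z * r z)%N.
  have [/inside/ltnW//|ht] := boolP (tA < t <= tB)%N.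
  apply: leq_sum => z _; by rewrite YE /swap_between (negPf ht).
rewrite /potential (bigD1 (Ordinal tBT)) //= [X in (_ < X)%N](bigD1 (Ordinal tBT)) //=.
rewrite -addSn leq_add ?inside //; first by lia.
by apply: leq_sum => t _; apply: weak.
Qed.

Lemma potential_bound r X : fits X -> (potential r X <= T * (n * (n * n)))%N.
Proof.
move=> fX; rewrite /potential.
have -> : (T * (n * (n * n)) = \sum_(t < T) \sum_(z : 'I_n) n * n)%N.
  by rewrite !sum_nat_const !card_ord.
apply: leq_sum => t _; apply: leq_sum => z _.
by rewrite leq_mul // ltnW // pos_lt.
Qed.

(** If [a < b], the inversion [r b < r a] is one of [v], so the two pipes still have to cross after
    the contact. If [b < a], they are already inverted at the contact and have crossed before.
    Either way there is a crossing to exchange with the contact. *)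
Lemma violating_swap X v r a b : good X v -> wle r v -> arc X a b -> (r b < r a)%N ->
  exists Y, good Y v /\ (potential r X < potential r Y)%N.
Proof.
move=> gX /wleP rv [t [i [Ft Xt ent]]] rba.
have [fX mX eX] := gX.
have tT : (t < T)%N by case/and3P: Ft => /hi_le; lia.
have pab : (pos X t a < pos X t b)%N by case: ent; lia.
case: (ltngtP a b) => [ab|ba|/val_inj e]; last by rewrite e ltnn in rba.
  have vba : (pos X T b < pos X T a)%N by rewrite !eX; apply: rv.
  have [u [j [tu Xu entu]]] := order_change fX (ltnW tT) pab vba.
  have tu' : (t < u)%N.
    rewrite ltn_neqAle (andP tu).1 andbT; apply/eqP => e; subst u.
    by move: Xu; case: entu => _ <-; case: ent => _ ->; rewrite Xt.
  have Fu := (fX _ _ Xu).2.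
  have one : X t i (+) X u j by rewrite Xt Xu.
  have mt : meets X t i a b by left.
  have mu : meets X u j a b by left.
  exists (toggle X t i u j); split; first exact: (toggle_good gX Ft Fu tu' mt mu).
  apply: (potential_lt (tA := t) (tB := u) (a := a) (b := b)) => //; first last.
  - move=> s hs; have := order_between fX Ft Fu tu' mt mu ab mX one s.
    have abN : pos X s a <> pos X s b by move/(pos_eq fX) => e; rewrite e ltnn in ab.
    by rewrite Xt; do !case: ifP; lia.
  - by lia.
  exact: pos_toggle.
have p0 : (pos X 0 b < pos X 0 a)%N by [].
have [u [j [tu Xu entu]]] := order_change fX (leq0n t) p0 pab.
have tu' : (u < t)%N by lia.
have Fu := (fX _ _ Xu).2.
have one : X u j (+) X t i by rewrite Xt Xu.
have mt : meets X t i b a by right.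
have mu : meets X u j b a by left.
exists (toggle X u j t i); split; first exact: (toggle_good gX Fu Ft tu' mu mt).
apply: (potential_lt (tA := u) (tB := t) (a := a) (b := b)) => //; first last.
- move=> s hs; have := order_between fX Fu Ft tu' mu mt ba mX one s.
  by rewrite Xu; do !case: ifP; lia.
- by lia.
by move=> s z; rewrite swap_betweenC; apply: pos_toggle.
Qed.

Lemma exists_compatible X0 v r : good X0 v -> wle r v ->
  exists X, good X v /\ compatible X v r.
Proof.
move=> + rv; have [m] := ubnP (T * (n * (n * n)) - potential r X0)%N.
elim: m X0 => // m IH X leX gX.
have [[a [b [ab rba]]]|none] := classic (exists a b, arc X a b /\ (r b < r a)%N).
  have [Y [gY lt]] := violating_swap gX rv ab rba.
  by apply: (IH Y) => //; have := potential_bound r (good_fits gY); lia.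
exists X; split=> //; split=> a b.
  move=> ab; case: (ltngtP (r a) (r b)) => // [rba|/val_inj/perm_inj e].
    by case: none; exists a, b.
  have [t [i [_ _ [h1 h2]]]] := ab; move: h1; rewrite -h2 e; lia.
move=> ab vab; case: (ltngtP (r a) (r b)) => // [rba|/val_inj/perm_inj e].
  by have := wleP _ _ rv a b ab rba; lia.
by rewrite e ltnn in ab.
Qed.

(** * Flips: exchanging a crossing with the last contact of the same pipes *)

Record flip_cells X x y tA iA tB iB : Prop := FlipCells {
  flip_cross : X tA iA;
  flip_enterA : enters X tA iA x y;
  flip_region : in_region tB iB;
  flip_contact : X tB iB = false;
  flip_enterB : enters X tB iB y x;
  flip_last : forall t i, (tB < t)%N -> in_region t i -> X t i = false -> ~ enters X t i y x }.

Lemma flip_lt X v x y tA iA tB iB : good X v -> (x < y)%N ->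
  flip_cells X x y tA iA tB iB -> (tA < tB)%N.
Proof.
move=> [fX mX _] xy [XA [? ?] _ XB [? ?] _]; rewrite ltnNge; apply/negP => tBA.
by have : (pos X tA y < pos X tA x)%N; [apply: (mX _ _ _ _ xy tBA); lia | lia].
Qed.

(** Taking the last contact from [y] to [x] matters: all such contacts follow the crossing, and the
    exchange reverses only those up to the chosen one. *)
Lemma flip_cells_exist X v x y : good X v -> (x < y)%N -> arc X y x ->
  exists tA iA tB iB, flip_cells X x y tA iA tB iB.
Proof.
move=> [fX mX eX] xy [t [i [F Xt ent]]].
have [m] := ubnP (T - t); elim: m t i F Xt ent => // m IH t i F Xt ent tm.
have [[t' [i' [tt' F' Xt' ent']]]|last] := classic (exists t' i',
    [/\ (t < t')%N, in_region t' i', X t' i' = false & enters X t' i' y x]).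
  apply: (IH t' i') => //; case/and3P: F' => /hi_le; lia.
have p0 : (pos X 0 x < pos X 0 y)%N by [].
have pt : (pos X t y < pos X t x)%N by case: ent; lia.
have [u [j [_ Xu entu]]] := order_change fX (leq0n t) p0 pt.
exists u, j, t, i; split=> // t' i' tt' F' Xt' ent'.
by case: last; exists t', i'.
Qed.

Section Flip.
Variables (X : nat -> nat -> bool) (v r : 'S_n) (x y : 'I_n) (tA iA tB iB : nat).
Hypotheses (gX : good X v) (cX : compatible X v r) (xy : (x < y)%N).
Hypotheses (ryx : (r y < r x)%N) (flip : flip_cells X x y tA iA tB iB).
Let Y := toggle X tA iA tB iB.

Lemma flip_pos t z : pos Y t z = pos X t (swap_between tA tB x y t z).
Proof.
have := flip_lt gX xy flip; case: flip => XA eA FB XB eB _ tAB.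
have [fX _ _] := gX.
by apply: pos_toggle => //; [case: (fX _ _ XA) | left | right].
Qed.

Lemma flip_good : good Y v.
Proof.
have := flip_lt gX xy flip; case: flip => XA eA FB XB eB _ tAB.
have FA := (good_fits gX XA).2.
by apply: (toggle_good gX FA FB tAB (x := x) (y := y)) => //; [left|right|rewrite XA XB].
Qed.

Lemma flip_entersA : [/\ in_region tA iA, Y tA iA = false & enters Y tA iA x y].
Proof.
have tAB := flip_lt gX xy flip; case: (flip) => XA eA FB XB eB _.
split; first by case: (good_fits gX XA).
  by rewrite /Y /toggle !eqxx XA.
by rewrite /enters !flip_pos /swap_between ltnn.
Qed.

Lemma flip_entersB : Y tB iB /\ enters Y tB iB x y.
Proof.
have tAB := flip_lt gX xy flip; case: (flip) => XA eA FB XB eB _.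
split; first by rewrite /Y /toggle !eqxx XB orbT.
by rewrite /enters !flip_pos /swap_between tAB leqnn tpermL tpermR.
Qed.

(** Before [tA] nothing has changed, and in [X] a contact from [x] to [y] would contradict
    [r y < r x]. *)
Lemma flip_first t i : (t < tA)%N -> in_region t i -> Y t i = false -> ~ enters Y t i x y.
Proof.
move=> ttA F; have tAB := flip_lt gX xy flip.
have -> : Y t i = X t i.
  by rewrite /Y /toggle (ltn_eqF ttA) (ltn_eqF (ltn_trans ttA tAB)) addbF.
rewrite /enters !flip_pos /swap_between (leq_gtF (ltnW ttA)) /= => Xt ent.
have : (r x < r y)%N by apply: cX.1; exists t, i.
by lia.
Qed.

Hypothesis adj : r x = (r y).+1 :> nat.

(** Between the two tiles the arcs are those of [X] with [x] and [y] renamed. Elsewhere they are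
    arcs of [X], and as the ranks of [x] and [y] are consecutive, only an arc from [y] to [x] could
    be violated. *)
Lemma flip_compatible : compatible Y v (tperm x y * r)%g.
Proof.
have tAB := flip_lt gX xy flip; have [fX mX eX] := gX.
case: (flip) => XA eA FB XB eB last; split; last first.
  move=> a b ab vab; have rab := cX.2 a b ab vab.
  have [[-> ->]|nxy] := classic (a = x /\ b = y); first exact: swap_rank_xy.
  have [[? ?]|nyx] := classic (a = y /\ b = x); first by subst; lia.
  by rewrite swap_rank_lt.
move=> a b [t [i [Ft Yt]]].
rewrite /enters !flip_pos /swap_between.
have [[? ?]|nA] := classic (t = tA /\ i = iA).
  subst t i; rewrite ltnn /= => -[ha hb]; case: eA => hx hy.
  have -> : b = y by apply: (pos_eq fX (t := tA)); lia.
  have -> : a = x by apply: (pos_eq fX (t := tA)); lia.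
  exact: swap_rank_xy.
have nB : ~ (t = tB /\ i = iB).
  by move=> [? ?]; subst t i; move: Yt; rewrite /Y /toggle !eqxx XB orbT.
have Xt : X t i = false.
  rewrite -Yt /Y /toggle.
  have -> : ((t == tA) && (i == iA)) = false by apply/andP => -[/eqP ? /eqP ?]; apply: nA.
  have -> : ((t == tB) && (i == iB)) = false by apply/andP => -[/eqP ? /eqP ?]; apply: nB.
  by rewrite addbF.
case: ifP => ht ent.
  by rewrite !permM; apply: cX.1; exists t, i.
have rab : (r a < r b)%N by apply: cX.1; exists t, i.
have [[? ?]|nxy] := classic (a = x /\ b = y); first by subst; lia.
have [[? ?]|nyx] := classic (a = y /\ b = x); last by rewrite swap_rank_lt.
(* An arc from [y] to [x] outside the interval would come after the last contact or before the
   crossing. *)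
subst a b; exfalso; have [tB'|tB'] := ltnP tB t; first exact: (last t i).
have tA' : (t <= tA)%N by lia.
have : (pos X tA y < pos X tA x)%N by apply: (mX _ _ _ _ xy tA'); case: ent; lia.
by case: eA; lia.
Qed.
End Flip.

(** * Uniqueness of the compatible pipe dream *)

Lemma pos_ext X Y t a : X =2 Y -> pos X t a = pos Y t a.
Proof. by move=> XY; elim: t => //= t ->; rewrite /step !XY. Qed.

Lemma cross_once X v x y t i t' i' : good X v -> (x < y)%N ->
  X t i -> enters X t i x y -> X t' i' -> enters X t' i' x y -> (t' <= t)%N.
Proof.
move=> [fX mX _] xy Xt et Xt' [h1 h2]; rewrite leqNgt; apply/negP => tt'.
have m : meets X t i x y by left.
have [_ o] := cross_order fX mX xy Xt m.
by have := mX _ _ _ _ xy tt' o; lia.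
Qed.

(** Both toggled tiles can be read off the result: they are the first contact from [x] to [y] and
    the unique crossing of these pipes. *)
Lemma flip_inj X1 X2 v r x y tA1 iA1 tB1 iB1 tA2 iA2 tB2 iB2 :
  good X1 v -> good X2 v -> compatible X1 v r -> compatible X2 v r ->
  (x < y)%N -> (r y < r x)%N ->
  flip_cells X1 x y tA1 iA1 tB1 iB1 -> flip_cells X2 x y tA2 iA2 tB2 iB2 ->
  toggle X1 tA1 iA1 tB1 iB1 =2 toggle X2 tA2 iA2 tB2 iB2 -> X1 =2 X2.
Proof.
move=> g1 g2 c1 c2 xy ryx f1 f2 E.
have gY1 := flip_good g1 xy f1; have gY2 := flip_good g2 xy f2.
have [F1 Y1 e1] := flip_entersA g1 xy f1; have [F2 Y2 e2] := flip_entersA g2 xy f2.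
have [Z1 d1] := flip_entersB g1 xy f1; have [Z2 d2] := flip_entersB g2 xy f2.
have n1 := flip_first g1 c1 xy ryx f1; have n2 := flip_first g2 c2 xy ryx f2.
set W1 := toggle X1 _ _ _ _ in E gY1 Y1 e1 Z1 d1 n1 *.
set W2 := toggle X2 _ _ _ _ in E gY2 Y2 e2 Z2 d2 n2 *.
have entE t i a b : enters W1 t i a b <-> enters W2 t i a b.
  by rewrite /enters !(pos_ext _ _ E).
have tA : tA1 = tA2.
  case: (ltngtP tA1 tA2) => // lt; exfalso.
    by apply: (n2 tA1 iA1) => //; [rewrite -E | apply/entE].
  by apply: (n1 tA2 iA2) => //; [rewrite E | apply/entE].
have iA : iA1 = iA2 by move: e1 => /entE [_ <-]; case: e2 => _ <-; rewrite tA.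
have tB : tB1 = tB2.
  apply: anti_leq; apply/andP; split.
    by apply: (cross_once gY2 xy Z2 d2 (i' := iB1)); [rewrite -E | apply/entE].
  by apply: (cross_once gY1 xy Z1 d1 (i' := iB2)); [rewrite E | apply/entE].
have iB : iB1 = iB2 by move: d1 => /entE [_ <-]; case: d2 => _ <-; rewrite tB.
subst=> t i; have := E t i; rewrite /W1 /W2 /toggle.
exact: addIb.
Qed.

(* At the identity there is no contact after a crossing, so a pipe dream is
   determined backwards from its exits. *)
Lemma identity_cell X v t i a b : good X v -> compatible X v 1%g -> in_region t i ->
  (0 < i < n)%N -> pos X t.+1 a = i.-1 -> pos X t.+1 b = i -> X t i = (b < a)%N.
Proof.
move=> [fX mX _] [cX _] F i0 ha hb.
have ti : ~~ odd (t + i) by case/and3P: F.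
case Xt: (X t i).
  have [s1 s2] := step_cross fX Xt.
  have ha' : pos X t a = i by rewrite pos_pred // ha.
  have hb' : pos X t b = i.-1 by rewrite pos_pred // hb.
  case: (ltngtP a b) => // [ab|/val_inj e]; last by move: ha'; rewrite e; lia.
  by have := mX _ _ _ _ ab (leqnSn t); rewrite ha hb ha' hb'; lia.
have [s1 s2] := step_contact fX ti Xt.
have ha' : pos X t a = i.-1 by rewrite pos_pred // ha.
have hb' : pos X t b = i by rewrite pos_pred // hb.
have /cX : arc X a b by exists t, i; split=> //; split=> //; lia.
by rewrite !perm1; lia.
Qed.

Lemma identity_unique X1 X2 v : good X1 v -> good X2 v ->
  compatible X1 v 1%g -> compatible X2 v 1%g -> X1 =2 X2.
Proof.
move=> g1 g2 c1 c2; have [f1 _ e1] := g1; have [f2 _ e2] := g2.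
have late X t i : fits X -> (T <= t)%N -> X t i = false.
  move=> fX Tt; apply/negP => /fX[_ /and3P[/hi_le]]; lia.
have main k : (forall t i, (T - k <= t)%N -> X1 t i = X2 t i) /\
    (forall a : 'I_n, pos X1 (T - k) a = pos X2 (T - k) a).
  elim: k => [|k [IHX IHp]].
    by rewrite subn0; split=> [t i Tt|a]; [rewrite (late X1) ?(late X2) | rewrite e1 e2].
  have [Tk|kT] := leqP T k.
    have -> : T - k.+1 = T - k by lia.
    by [].
  set t := T - k.+1; have tE : T - k = t.+1 by lia.
  rewrite tE in IHX IHp.
  have Xt i : X1 t i = X2 t i.
    have [Fi|nF] := boolP (in_region t i && (0 < i < n)%N); last first.
      have out X : fits X -> X t i = false.
        by move=> fX; apply/negP => /fX[h1 h2]; rewrite h1 h2 in nF.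
      by rewrite (out X1) ?(out X2).
    case/andP: Fi => Fi i0.
    have [i1n i2n] : (i.-1 < n)%N /\ (i < n)%N by lia.
    have [a ha] := pos_surj t.+1 f1 i1n; have [b hb] := pos_surj t.+1 f1 i2n.
    rewrite (identity_cell g1 c1 Fi i0 ha hb).
    by rewrite (identity_cell g2 c2 Fi i0 (a := a) (b := b)) // -IHp.
  split=> [u i|a].
    by rewrite leq_eqVlt => /orP[/eqP<-//|]; apply: IHX.
  by rewrite (pos_pred _ _ f1) (pos_pred _ _ f2) IHp /step !Xt.
by move=> t i; have [h _] := main T; apply: h; lia.
Qed.

Lemma compatible_of_no_arc X v r x y : compatible X v r -> (x < y)%N ->
  r x = (r y).+1 :> nat -> ~ arc X y x -> compatible X v (tperm x y * r)%g.
Proof.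
move=> [c1 c2] xy adj nyx; split=> a b.
  move=> ab; have rab := c1 a b ab.
  have [[? ?]|h1] := classic (a = x /\ b = y); first by subst; lia.
  have [[? ?]|h2] := classic (a = y /\ b = x); first by subst.
  by rewrite swap_rank_lt.
move=> ab vab; have rab := c2 a b ab vab.
have [[-> ->]|h1] := classic (a = x /\ b = y); first exact: swap_rank_xy.
have [[? ?]|h2] := classic (a = y /\ b = x); first by subst; lia.
by rewrite swap_rank_lt.
Qed.

Lemma arc_ext X Y a b : X =2 Y -> arc X a b -> arc Y a b.
Proof.
move=> XY [t [i [F Xt e]]]; exists t, i; split=> //; first by rewrite -XY.
by rewrite /enters -!(pos_ext _ _ XY).
Qed.

Lemma compatible_unique X1 X2 v r : good X1 v -> good X2 v ->
  compatible X1 v r -> compatible X2 v r -> X1 =2 X2.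
Proof.
have [m] := ubnP #|inversions r|; elim: m r X1 X2 => // m IH r X1 X2 rm g1 g2 c1 c2.
have [r1|r1] := eqVneq r 1%g; first by subst; apply: (identity_unique g1 g2).
have id_le : wle 1%g r by apply/wleP => a b; rewrite !perm1; lia.
have [x [y [xy adj _]]] := exists_descent id_le (fun e => negP r1 (introT eqP (esym e))).
have ryx : (r y < r x)%N by lia.
have lt := leq_trans (card_inversions_swap adj xy) rm.
(* If only [Z1] had an arc from [y] to [x], its flip would equal [Z2] by induction one step lower;
   but the flip has a contact from [x] to [y], which [r] forbids in [Z2]. *)
have mixed Z1 Z2 : good Z1 v -> good Z2 v -> compatible Z1 v r -> compatible Z2 v r ->
    arc Z1 y x -> arc Z2 y x.
  move=> h1 h2 k1 k2 a1; apply: NNPP => a2.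
  have [tA [iA [tB [iB f]]]] := flip_cells_exist h1 xy a1.
  have E := IH _ _ _ lt (flip_good h1 xy f) h2 (flip_compatible h1 k1 xy ryx f adj)
    (compatible_of_no_arc k2 xy adj a2).
  have [F Y e] := flip_entersA h1 xy f.
  have : arc Z2 x y by apply: (arc_ext E); exists tA, iA.
  by move/(k2.1); lia.
have [a1|a1] := classic (arc X1 y x).
  have a2 := mixed _ _ g1 g2 c1 c2 a1.
  have [tA [iA [tB [iB f1]]]] := flip_cells_exist g1 xy a1.
  have [tA' [iA' [tB' [iB' f2]]]] := flip_cells_exist g2 xy a2.
  apply: (flip_inj g1 g2 c1 c2 xy ryx f1 f2).
  apply: (IH _ _ _ lt (flip_good g1 xy f1) (flip_good g2 xy f2)).
    exact: flip_compatible.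
  exact: flip_compatible.
have a2 : ~ arc X2 y x by move/(mixed _ _ g2 g1 c2 c1).
by apply: (IH _ _ _ lt g1 g2); apply: compatible_of_no_arc.
Qed.

(** * Elbows in a rectangle *)

Lemma lipschitz (f : nat -> nat) :
  (forall i, (i < n)%N -> f i.+1 = (f i).+1 \/ f i = (f i.+1).+1) ->
  forall i d, (i + d <= n)%N -> (f (i + d) <= f i + d)%N /\ (f i <= f (i + d) + d)%N.
Proof.
move=> hf i; elim=> [|d IH] h; first by rewrite !addn0.
have h' : (i + d < n)%N by lia.
by have := IH (ltnW h'); have := hf _ h'; rewrite addnS; lia.
Qed.

(* The region is convex for the product order of grid coordinates
   [((t + i) / 2, (t - i) / 2)]. *)
Lemma region_between tU iU tZ iZ tV iV : in_region tU iU -> in_region tV iV ->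
  ~~ odd (tZ + iZ) -> (iZ <= n)%N ->
  (tU + iZ <= tZ + iU)%N -> (tU + iU <= tZ + iZ)%N ->
  (tZ + iV <= tV + iZ)%N -> (tZ + iZ <= tV + iV)%N -> in_region tZ iZ.
Proof.
move=> /and3P[iUn /andP[lU _] _] /and3P[iVn /andP[_ hV] _] odZ iZn h1 h2 h3 h4.
rewrite /in_region iZn odZ andbT /=; apply/andP; split.
  case: (leqP iU iZ) => hi'.
    by have := lipschitz lo_step (i := iU) (d := iZ - iU); rewrite subnKC //; lia.
  by have := lipschitz lo_step (i := iZ) (d := iU - iZ); rewrite subnKC //; lia.
case: (leqP iV iZ) => hi'.
  by have := lipschitz hi_step (i := iV) (d := iZ - iV); rewrite subnKC //; lia.
by have := lipschitz hi_step (i := iZ) (d := iV - iZ); rewrite subnKC //; lia.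
Qed.

(** * Straight runs of a pipe *)

Section Runs.
Variables (X : nat -> nat -> bool) (fX : fits X).

Lemma odd_no_cross t i : odd (t + i) -> X t i = false.
Proof. by move=> h; apply/negP => /(fits_parity fX); rewrite h. Qed.

(** The four [run] lemmas follow a pipe straight, backwards in time to the south and west, forwards
    to the north and east, until it meets an elbow or the given distance is covered. *)
Lemma run_south t i p (b : nat) : ~~ odd (t + i) -> pos X t p = i -> (0 < b <= t)%N ->
  (X (t - b) (i + b) /\ pos X (t - b) p = i + b) \/
  (exists k, [/\ (0 < k <= b)%N, X (t - k) (i + k) = false & (pos X (t - k) p).+1 = i + k]).
Proof.
move=> ti hp; elim: b => // b IH /andP[_ bt].
have back : pos X (t - b) p = i + b ->
    pos X (t - b.+1) p = if X (t - b.+1) (i + b.+1) then i + b.+1 else i + b.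
  move=> h; rewrite (pos_pred _ _ fX) (_ : (t - b.+1).+1 = t - b); last by lia.
  by rewrite h /step (@odd_no_cross _ (i + b)) ?addnS //; lia.
case: b IH bt back => [|b] IH bt back.
  move: back; rewrite subn0 addn0 => /(_ hp).
  case: ifP => [Xh h|Xh h]; first by left.
  by right; exists 1%N; split=> //; rewrite h addn1.
case: IH => [|[_ h]|[k [k1 k2 k3]]]; first by lia.
  move: (back h); case: ifP => [Xh h'|Xh h']; first by left.
  by right; exists b.+2; split=> //; rewrite ?h'; lia.
by right; exists k; split=> //; lia.
Qed.

Lemma run_east t i p (a : nat) : ~~ odd (t + i) -> pos X t.+1 p = i -> (0 < a)%N ->
  (X (t + a) (i + a) /\ (pos X (t + a) p).+1 = i + a) \/
  (exists k, [/\ (0 < k <= a)%N, X (t + k) (i + k) = false & (pos X (t + k) p).+1 = i + k]).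
Proof.
move=> ti hp; elim: a => // a IH _.
have forth : pos X (t + a.+1) p = i + a ->
    (X (t + a.+1) (i + a.+1) /\ (pos X (t + a.+1) p).+1 = i + a.+1) \/
    (X (t + a.+1) (i + a.+1) = false /\ (pos X (t + a.+1) p).+1 = i + a.+1).
  move=> h; have h' : (pos X (t + a.+1) p).+1 = i + a.+1 by rewrite h addnS.
  by case: (X _ _); [left|right].
case: a IH forth => [|a] IH forth.
  move: forth; rewrite addn1 addn0 => /(_ hp) [h|[h1 h2]]; first by left; rewrite !addn1 in h *.
  by right; exists 1%N; rewrite !addn1 in h1 h2 *.
case: IH => [//|[Xh h]|[k [k1 k2 k3]]]; last first.
  by right; exists k; split=> //; lia.
have e : pos X (t + a.+2) p = i + a.+1.
  rewrite addnS /= /step (@odd_no_cross _ (pos X (t + a.+1) p)); last by lia.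
  by rewrite h Xh.
case: (forth e) => [?|[? ?]]; first by left.
by right; exists a.+2; split=> //; lia.
Qed.

Lemma run_west t i q (a : nat) : ~~ odd (t + i) -> (pos X t q).+1 = i -> (0 < a <= t)%N ->
  [/\ (a < i)%N, X (t - a) (i - a) & (pos X (t - a) q).+1 = i - a] \/
  (exists k, [/\ (0 < k <= a)%N, (k <= i)%N, X (t - k) (i - k) = false & pos X (t - k) q = i - k]).
Proof.
move=> ti hq; elim: a => // a IH /andP[_ ha].
have back : (a < i)%N -> (pos X (t - a) q).+1 = i - a ->
    pos X (t - a.+1) q = if X (t - a.+1) (i - a.+1) then (i - a.+1).-1 else i - a.+1.
  move=> ai h; rewrite (pos_pred _ _ fX) (_ : (t - a.+1).+1 = t - a); last by lia.
  have -> : pos X (t - a) q = i - a.+1 by lia.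
  rewrite /step; case: ifP => // _.
  by rewrite (@odd_no_cross _ (i - a.+1).+1) //; lia.
have finish : (a < i)%N -> (pos X (t - a) q).+1 = i - a ->
  [/\ (a.+1 < i)%N, X (t - a.+1) (i - a.+1) & (pos X (t - a.+1) q).+1 = i - a.+1] \/
  (exists k, [/\ (0 < k <= a.+1)%N, (k <= i)%N, X (t - k) (i - k) = false & pos X (t - k) q = i - k]).
  move=> ai h; move: (back ai h); case: ifP => [Xh h'|Xh h'].
    by have [i0 _] := fX Xh; left; split=> //; lia.
  by right; exists a.+1; split=> //; lia.
case: a IH ha finish back => [|a] IH ha finish _.
  by apply: finish; rewrite ?subn0; lia.
case: IH => [|[h1 h2 h3]|[k [k1 k2 k3 k4]]]; first by lia.
  exact: finish.
by right; exists k; split=> //; lia.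
Qed.

Lemma run_north t i q (b : nat) : ~~ odd (t + i) -> (pos X t.+1 q).+1 = i -> (0 < b <= i)%N ->
  (X (t + b) (i - b) /\ pos X (t + b) q = i - b) \/
  (exists k, [/\ (0 < k <= b)%N, X (t + k) (i - k) = false & pos X (t + k) q = i - k]).
Proof.
move=> ti hq; elim: b => // b IH /andP[_ hb].
have finish : pos X (t + b.+1) q = i - b.+1 ->
  (X (t + b.+1) (i - b.+1) /\ pos X (t + b.+1) q = i - b.+1) \/
  (exists k, [/\ (0 < k <= b.+1)%N, X (t + k) (i - k) = false & pos X (t + k) q = i - k]).
  move=> h; case Xh: (X (t + b.+1) (i - b.+1)); first by left.
  by right; exists b.+1; split=> //; lia.
case: b IH hb finish => [|b] IH hb finish.
  by apply: finish; rewrite addn1; lia.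
case: IH => [|[Xh h]|[k [k1 k2 k3]]]; first by lia.
  apply: finish; rewrite addnS /= h /step Xh; lia.
by right; exists k; split=> //; lia.
Qed.

(** This is the diagonal of the cell entered at time [t] from the strip [j], through its west side
    if [t + j] is odd and its south side otherwise. *)
Definition cell_of t j : nat := if odd (t + j) then j.+1 else j.

(** Pipes only move north and east, so neither grid coordinate, half of [t - i] or of [t + i], ever
    decreases. *)
Lemma path_monotone t t' p : (t <= t')%N ->
  (cell_of t' (pos X t' p) + t <= cell_of t (pos X t p) + t')%N /\
  (cell_of t (pos X t p) + t <= cell_of t' (pos X t' p) + t')%N.
Proof.
move=> /subnKC <-; elim: (t' - t) => [|d [IH1 IH2]]; first by rewrite addn0.
suff h u : (cell_of u.+1 (pos X u.+1 p) <= cell_of u (pos X u p) + 1)%N /\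
   (cell_of u (pos X u p) <= cell_of u.+1 (pos X u.+1 p) + 1)%N.
  by rewrite addnS; have := h (t + d); lia.
rewrite /cell_of /= /step; set j := pos X u p.
case odj: (odd (u + j)).
  by rewrite (odd_no_cross odj); case: (X u j.+1); case: ifP; lia.
case Xj: (X u j); first by have [i0 _] := fX Xj; case: ifP; lia.
by rewrite (@odd_no_cross _ j.+1); [case: ifP; lia | lia].
Qed.
End Runs.

(* If the south-east elbow of [p] at a contact C lies strictly north-west of
   the north-west elbow of [q] at a contact D, the pipe [p] met first when
   leaving C southwards or eastwards, or [q] when leaving D northwards or
   westwards, can be exchanged for a closer pipe; otherwise [p] and [q] run along
   the whole sides of the rectangle and cross at both other corners. *)
Lemma rectangle X v r p q t i (a b : nat) : good X v ->
  (forall c d, arc X c d -> (r c < r d)%N) ->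
  (0 < a + b)%N ->
  (forall j k, (j <= a)%N -> (k <= b)%N -> in_region (t + j + k) (i + b + j - k)) ->
  X (t + b) i = false -> pos X (t + b) p = i ->
  X (t + a) (i + b + a) = false -> (pos X (t + a) q).+1 = i + b + a ->
  (r p <= r q)%N.
Proof.
move=> [fX mX _] rX; have [m] := ubnP (a + b).
elim: m t i a b p q => // m IH t i a b p q abm ab0 reg XC hp XD hq.
have par j k : (j <= a)%N -> (k <= b)%N -> ~~ odd (t + j + k + (i + b + j - k)).
  by move=> ja kb; case/and3P: (reg j k ja kb).
have pC : ~~ odd (t + b + i) by have := par 0 b; lia.
have pD : ~~ odd (t + a + (i + b + a)) by have := par a 0; lia.
have qn : (pos X (t + a) q < n)%N by apply: pos_lt.
have arc_lt j k c (d : 'I_n) : (j <= a)%N -> (k <= b)%N -> X (t + j + k) (i + b + j - k) = false ->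
    (pos X (t + j + k) c).+1 = i + b + j - k -> pos X (t + j + k) d = i + b + j - k ->
    (r c < r d)%N.
  by move=> ja kb ? ? ?; apply: rX; exists (t + j + k), (i + b + j - k); split=> //; apply: reg.
have same u c (d : 'I_n) : pos X u c = pos X u d -> c = d by apply: pos_eq.
have pE : pos X (t + b).+1 p = i.
  have [s _] := step_contact fX pC XC; by rewrite /= hp s.
have qN : (pos X (t + a).+1 q).+1 = i + b + a.
  have [_ s] := step_contact fX pD XD.
  by rewrite /= (_ : pos X (t + a) q = (i + b + a).-1) ?s; lia.
(* At the elbow found on the run, [p] has an arc to the pipe [p'] of the south-east elbow, and the
   rectangle from there to [D] is smaller. If this elbow is [D] itself, then [p = q]. The other
   three sides are analogous. *)
have south k : (0 < k <= b)%N -> X (t + b - k) (i + k) = false ->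
    (pos X (t + b - k) p).+1 = i + k -> (r p <= r q)%N.
  move=> hk Xk pk; have [kD|kD] := eqVneq (i + k) (i + b + a).
    have [? ?] : k = b /\ a = 0 by lia.
    subst k a; rewrite (same t p q) //.
    by move: pk hq; rewrite addnK !addn0; lia.
  have kn : (i + k < n)%N by lia.
  have [p' hp'] := pos_surj (t + b - k) fX kn.
  have lt : (r p < r p')%N.
    have E1 : t + b - k = t + 0 + (b - k) by lia.
    have E2 : i + k = i + b + 0 - (b - k) by lia.
    by apply: (arc_lt 0 (b - k)); rewrite -?E1 -?E2 //; lia.
  apply: leq_trans (ltnW lt) _.
  apply: (IH t (i + k) a (b - k)); try lia.
  - move=> j l ja lb; have := reg j l ja; rewrite (_ : i + k + (b - k) = i + b); last by lia.
    by apply; lia.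
  - by have -> : t + (b - k) = t + b - k by lia.
  - by have -> : t + (b - k) = t + b - k by lia.
  - by have -> : i + k + (b - k) = i + b by lia.
have east k : (0 < k <= a)%N -> X (t + b + k) (i + k) = false ->
    (pos X (t + b + k) p).+1 = i + k -> (r p <= r q)%N.
  move=> hk Xk pk; have [kD|kD] := eqVneq (i + k) (i + b + a).
    have [? ?] : k = a /\ b = 0 by lia.
    subst k b; rewrite (same (t + a) p q) //.
    by move: pk hq; rewrite !addn0; lia.
  have kn : (i + k < n)%N by lia.
  have [p' hp'] := pos_surj (t + b + k) fX kn.
  have lt : (r p < r p')%N.
    have E1 : t + b + k = t + k + b by lia.
    have E2 : i + k = i + b + k - b by lia.
    by apply: (arc_lt k b); rewrite -?E1 -?E2 //; lia.
  apply: leq_trans (ltnW lt) _.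
  apply: (IH (t + k) (i + k) (a - k) b); try lia.
  - move=> j l ja lb; have := reg (k + j) l; rewrite addnA.
    by rewrite (_ : i + k + b + j - l = i + b + (k + j) - l); [apply; lia | lia].
  - by have -> : t + k + b = t + b + k by lia.
  - by have -> : t + k + b = t + b + k by lia.
  - by have [-> ->] : t + k + (a - k) = t + a /\ i + k + b + (a - k) = i + b + a by lia.
  - have -> : t + k + (a - k) = t + a by lia.
    by rewrite hq; lia.
have north k : (0 < k <= b)%N -> X (t + a + k) (i + b + a - k) = false ->
    pos X (t + a + k) q = i + b + a - k -> (r p <= r q)%N.
  move=> hk Xk qk; have [kC|kC] := eqVneq (i + b + a - k) i.
    have [? ?] : k = b /\ a = 0 by lia.
    subst k a; rewrite (same (t + b) p q) //.
    by move: qk; rewrite !addn0 !addnK => ->; rewrite hp.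
  have kn : ((i + b + a - k).-1 < n)%N by lia.
  have [q' hq'] := pos_surj (t + a + k) fX kn.
  have lt : (r q' < r q)%N by apply: (arc_lt a k) => //; lia.
  apply: leq_trans (ltnW lt).
  apply: (IH (t + k) i a (b - k)); try lia.
  - move=> j l ja lb; have := reg j (k + l).
    rewrite (_ : t + j + (k + l) = t + k + j + l); last by lia.
    by rewrite (_ : i + b + j - (k + l) = i + (b - k) + j - l); [apply; lia | lia].
  - by have -> : t + k + (b - k) = t + b by lia.
  - by have -> : t + k + (b - k) = t + b by lia.
  - by have [-> ->] : t + k + a = t + a + k /\ i + (b - k) + a = i + b + a - k by lia.
  - have -> : t + k + a = t + a + k by lia.
    by rewrite hq'; lia.
have west k : (0 < k <= a)%N -> X (t + a - k) (i + b + a - k) = false ->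
    pos X (t + a - k) q = i + b + a - k -> (r p <= r q)%N.
  move=> hk Xk qk; have [kC|kC] := eqVneq (i + b + a - k) i.
    have [? ?] : k = a /\ b = 0 by lia.
    subst k b; rewrite (same t p q) //.
    by move: qk; rewrite !addn0 !addnK => ->; rewrite -hp addn0.
  have kn : ((i + b + a - k).-1 < n)%N by lia.
  have [q' hq'] := pos_surj (t + a - k) fX kn.
  have lt : (r q' < r q)%N.
    have E1 : t + a - k = t + (a - k) + 0 by lia.
    have E2 : i + b + a - k = i + b + (a - k) - 0 by lia.
    by apply: (arc_lt (a - k) 0); rewrite -?E1 -?E2 //; lia.
  apply: leq_trans (ltnW lt).
  apply: (IH t i (a - k) b); try lia.
  - by move=> j l ja lb; apply: reg; lia.
  - by have [-> ->] : t + (a - k) = t + a - k /\ i + b + (a - k) = i + b + a - k by lia.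
  - have -> : t + (a - k) = t + a - k by lia.
    by rewrite hq'; lia.
(* In a flat rectangle a straight run would end at [D], which is a contact, so an elbow is found. *)
have [a0|a0] := posnP a.
  subst a; have [|[XZ _]|[k [? ? ?]]] := run_south fX pC hp (b := b); first lia.
    by move: XZ XD; rewrite addnK !addn0 => ->.
  exact: (south k).
have [b0|b0] := posnP b.
  subst b; have [|[XZ _]|[k [? ? ?]]] := run_east fX pC pE (a := a); first lia.
    by move: XZ XD; rewrite !addn0 => ->.
  exact: (east k).
have [|[XZ pZ]|[k [? ? ?]]] := run_south fX pC hp (b := b); [lia | | exact: (south k)].
have [|[XV pV]|[k [? ? ?]]] := run_east fX pC pE (a := a); [lia | | exact: (east k)].
have [|[XV' qV]|[k [? ? ?]]] := run_north pD qN (b := b); [lia | | exact: (north k)].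
have [|[_ XZ' qZ]|[k [? ? ? ?]]] := run_west fX pD hq (a := a); [lia | | exact: (west k)].
rewrite addnK in XZ pZ; rewrite !addnK in qZ.
have tV : t + a + b = t + b + a by lia.
rewrite tV in qV.
have mZ : meets X t (i + b) p q by right.
have mV : meets X (t + b + a) (i + a) q p by right; split=> //; lia.
(* [p] and [q] now cross at both remaining corners with opposite sides of entry, whereas the smaller
   label always enters a crossing from the west. *)
case: (ltngtP p q) => [pq|qp|/val_inj ->] //.
  by have [[h1 h2] _] := cross_order fX mX pq XZ mZ; lia.
by have [[h1 h2] _] := cross_order fX mX qp XV mV; lia.
Qed.

(* [E] and [D] are the last elbows of [p] and [q] before their crossing [V];
   [U] bounds from below the fourth corner of the rectangle that they span. *)
Lemma crossing_bound X v r p q tU iU tV iV l k : good X v ->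
  (forall c (d : 'I_n), arc X c d -> (r c < r d)%N) ->
  X tV iV -> enters X tV iV p q -> in_region tU iU ->
  (0 < l <= tV)%N -> (l <= iV)%N -> X (tV - l) (iV - l) = false ->
  pos X (tV - l) p = iV - l ->
  (0 < k <= tV)%N -> X (tV - k) (iV + k) = false -> (pos X (tV - k) q).+1 = iV + k ->
  (tU + iU <= (tV - l) + (iV - l))%N -> (tU + (iV + k) <= (tV - k) + iU)%N ->
  (r p <= r q)%N.
Proof.
move=> gX rX XV [eV1 eV2] FU l0 liV XE hp k0 XD hq h1 h2.
have [fX _ _] := gX.
have [iV0 FV] := fX _ _ XV.
have kn : (iV + k <= n)%N by have := pos_lt (tV - k) q fX; lia.
have pV : ~~ odd (tV + iV) by case/and3P: FV.
have e1 : tV - l - k + k = tV - l by lia.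
have e2 : tV - l - k + l = tV - k by lia.
have e3 : iV - l + k + l = iV + k by lia.
apply: (rectangle (t := tV - l - k) (i := iV - l) (a := l) (b := k) gX rX).
- by lia.
- by move=> j m jl mk; apply: (region_between FU FV); lia.
- by rewrite e1.
- by rewrite e1.
- by rewrite e2 e3.
by rewrite e2 e3.
Qed.

Lemma cell_of_S X t i p : ~~ odd (t + i) -> pos X t p = i -> cell_of t (pos X t p) = i.
Proof. by move=> ti ->; rewrite /cell_of (negPf ti). Qed.

Lemma cell_of_W X t i p : ~~ odd (t + i) -> (pos X t p).+1 = i -> cell_of t (pos X t p) = i.
Proof. by move=> ti hp; rewrite /cell_of; case: ifP; lia. Qed.

Lemma cross_gt0 X t i : fits X -> X t i -> (0 < t)%N.
Proof. by move=> fX /fX[_ /and3P[/lo_gt0]]; lia. Qed.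

(* After a contact from [z] to [x], the pipe [y] still has to cross exactly one of
   the two, at V, and it has crossed the other one before, at U. *)
Lemma no_arc_321 X v r x y z : good X v -> compatible X v r ->
  (x < y)%N -> (y < z)%N -> (r z < r y)%N -> (r y < r x)%N ->
  (v z < v y)%N -> (v y < v x)%N -> ~ arc X z x.
Proof.
move=> gX [rX _] xy yz rzy ryx vzy vyx [tC [iC [FC XC [eC1 eC2]]]].
have [fX mX eX] := gX.
have pC : ~~ odd (tC + iC) by case/and3P: FC.
have tCT : (tC <= T)%N by case/and3P: FC => /hi_le hT /andP[_ /ltnW tC'] _; apply: leq_trans tC' hT.
have yz' : pos X tC y <> pos X tC z by move/(pos_eq fX) => e; rewrite e ltnn in yz.
have yx' : pos X tC y <> pos X tC x by move/(pos_eq fX) => e; rewrite e ltnn in xy.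
(* If [y] passes north-west of the contact, it has crossed [x] at [U] and will cross [z] at [V];
   otherwise the roles of [x] and [z] are exchanged. *)
have [yC|Cy] := leqP (pos X tC y) iC.
  have ltyz : (pos X tC y < pos X tC z)%N by clear -yC yz' yx' eC1 eC2; lia.
  have ltyx : (pos X tC y < pos X tC x)%N by clear -yC yz' yx' eC1 eC2; lia.
  have gtT : (pos X T z < pos X T y)%N by rewrite !eX.
  have [tV [iV [tCV XV eV]]] := order_change fX tCT ltyz gtT.
  have [tU [iU [tUC XU [eU1 eU2]]]] := order_change fX (leq0n tC) (xy : pos X 0 x < pos X 0 y)%N ltyx.
  have [_ FU] := fX _ _ XU; have [_ FV] := fX _ _ XV; have [eV1 eV2] := eV.
  have pU : ~~ odd (tU + iU) by case/and3P: FU.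
  have pV : ~~ odd (tV + iV) by case/and3P: FV.
  have tVC : (tC < tV)%N.
    rewrite ltn_neqAle (andP tCV).1 andbT; apply/eqP => e; subst tV; clear -pC pV eC1 eC2 eV1 eV2; lia.
  (* Followed backwards from [V], the pipe [z] has an elbow at [C] or after it, since it enters [C]
     from the west. *)
  have [|[_ h]|[k [k1 k2 k3]]] := run_south fX pV eV2 (b := tV - tC); first by clear -tVC; lia.
    by move: h; rewrite subKn ?(ltnW tVC) //; clear -tVC pC pV eC1; lia.
  have := cross_gt0 fX XV => tV0.
  (* The pipe [y] must also turn: a straight run of this length would reach time [0] or diagonal
     [0], where there is no cross. *)
  have [|[a1 a2 a3]|[l [l1 l2 l3 l4]]] := run_west fX pV eV1 (a := minn tV iV).
  - by have [iV0 _] := fX _ _ XV; clear -iV0 tV0; lia.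
  - by have := cross_gt0 fX a2; clear -a1; lia.
  have pE : ~~ odd (tV - l + (iV - l)) by clear -pV l1 l2; lia.
  have pD : ~~ odd (tV - k + (iV + k)) by clear -pV k1; lia.
  have cU := cell_of_W pU eU1; have cU' := cell_of_S pU eU2.
  have cC := cell_of_W pC eC1; have cC' := cell_of_S pC eC2.
  have cE := cell_of_S pE l4; have cD := cell_of_W pD k3.
  have tUC' : (tU <= tC)%N by clear -tUC; lia.
  have tCD : (tC <= tV - k)%N by clear -k1 tVC; lia.
  (* [U] precedes [C] along [x], and [C] precedes [D] along [z]. Hence [E] does not come before [U]
     on [y]: it shares the value of [t - i] with [V], which exceeds that of [D] and so that of
     [U]. *)
  have := path_monotone fX x tUC'; have := path_monotone fX z tCD.
  rewrite cU cC cC' cD => -[h1 h2] [h3 h4].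
  have hUE : (tU + iU <= tV - l + (iV - l))%N.
    have [tUE|/ltnW tEU] := leqP tU (tV - l).
      by have := path_monotone fX y tUE; rewrite cU' cE; clear -l1; lia.
    by have := path_monotone fX y tEU; rewrite cU' cE; clear -l1 l2 k1 h1 h2 h3 h4 tVC tUC; lia.
  have tVl : (0 < l <= tV)%N by clear -l1; lia.
  have tVk : (0 < k <= tV)%N by clear -k1; lia.
  have hUD : (tU + (iV + k) <= tV - k + iU)%N by clear -h1 h2 h3 h4 k1 tUC tVC; lia.
  have := crossing_bound gX rX XV eV FU tVl l2 l3 l4 tVk k2 k3 hUE hUD.
  by rewrite leqNgt rzy.
have ltxy : (pos X tC x < pos X tC y)%N by clear -Cy eC1 eC2; lia.
have ltzy : (pos X tC z < pos X tC y)%N by clear -Cy eC1 eC2; lia.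
have gtT : (pos X T y < pos X T x)%N by rewrite !eX.
have [tV [iV [tCV XV eV]]] := order_change fX tCT ltxy gtT.
have [tU [iU [tUC XU [eU1 eU2]]]] := order_change fX (leq0n tC) (yz : pos X 0 y < pos X 0 z)%N ltzy.
have [_ FU] := fX _ _ XU; have [_ FV] := fX _ _ XV; have [eV1 eV2] := eV.
have pU : ~~ odd (tU + iU) by case/and3P: FU.
have pV : ~~ odd (tV + iV) by case/and3P: FV.
have tVC : (tC < tV)%N.
  rewrite ltn_neqAle (andP tCV).1 andbT; apply/eqP => e; subst tV; clear -pC pV eC1 eC2 eV1 eV2; lia.
have tV0 := cross_gt0 fX XV.
have [|[a1 a2 a3]|[l [l1 l2 l3 l4]]] := run_west fX pV eV1 (a := tV - tC); first by clear -tVC; lia.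
  by move: a3; rewrite subKn ?(ltnW tVC) //; clear -tVC pC pV eC2 a1; lia.
have [|[a1 a2]|[k [k1 k2 k3]]] := run_south fX pV eV2 (b := minn tV n).
- by have [iV0 _] := fX _ _ XV; clear -iV0 tV0; lia.
- by have := cross_gt0 fX a1; have [i0 _] := fX _ _ a1; clear -i0; lia.
have pE : ~~ odd (tV - l + (iV - l)) by clear -pV l1 l2; lia.
have pD : ~~ odd (tV - k + (iV + k)) by clear -pV k1; lia.
have cU := cell_of_W pU eU1; have cU' := cell_of_S pU eU2.
have cC := cell_of_W pC eC1; have cC' := cell_of_S pC eC2.
have cE := cell_of_S pE l4; have cD := cell_of_W pD k3.
have tUC' : (tU <= tC)%N by clear -tUC; lia.
have tCE : (tC <= tV - l)%N by clear -l1 tVC; lia.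
have := path_monotone fX z tUC'; have := path_monotone fX x tCE.
rewrite cU' cC cC' cE => -[h1 h2] [h3 h4].
have hUD : (tU + (iV + k) <= tV - k + iU)%N.
  have [tUD|/ltnW tDU] := leqP tU (tV - k).
    by have := path_monotone fX y tUD; rewrite cU cD; clear -k1; lia.
  by have := path_monotone fX y tDU; rewrite cU cD; clear -l1 l2 k1 h1 h2 h3 h4 tVC tUC; lia.
have tVl : (0 < l <= tV)%N by clear -l1; lia.
have tVk : (0 < k <= tV)%N by clear -k1; lia.
have hUE : (tU + iU <= tV - l + (iV - l))%N by clear -h1 h2 h3 h4 l1 l2 tUC tVC; lia.
have := crossing_bound gX rX XV eV FU tVl l2 l3 l4 tVk k2 k3 hUE hUD.
by rewrite leqNgt ryx.
Qed.

(** * Contraction of the weak order *)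

Lemma compatible_ext X Y v r : X =2 Y -> compatible X v r -> compatible Y v r.
Proof.
move=> XY [cX cv]; split=> // a b ab; apply: cX; apply: (arc_ext _ ab) => t i.
by rewrite XY.
Qed.

Lemma compatible_wle X v r : compatible X v r -> wle r v.
Proof.
move=> [_ cv]; apply/wleP => a b ab rba; rewrite ltnNge; apply/negP => vab.
have : (v a < v b)%N.
  rewrite ltn_neqAle vab andbT; apply/eqP => /val_inj/perm_inj e.
  by rewrite e ltnn in ab.
by move/(cv a b ab); lia.
Qed.

Section NormalForms.
Variable v : 'S_n.

Definition same_class r s : Prop :=
  exists X, [/\ good X v, compatible X v r & compatible X v s].

Definition contracts r s : Prop := exists x y,
  [/\ (x < y)%N, r x = (r y).+1 :> nat, s = (tperm x y * r)%g & same_class r s].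

Inductive reduces : 'S_n -> 'S_n -> Prop :=
| reduces_refl r : reduces r r
| reduces_step r s u : contracts r s -> reduces s u -> reduces r u.

Definition irreducible r : Prop := forall s, ~ contracts r s.

Definition normal_form r d : Prop := reduces r d /\ irreducible d.

Lemma contracts_wle r s : contracts r s -> wle s r.
Proof. by move=> [x [y [xy adj -> _]]]; apply: swap_wle. Qed.

Lemma contracts_card r s : contracts r s -> (#|inversions s| < #|inversions r|)%N.
Proof. by move=> [x [y [xy adj -> _]]]; apply: card_inversions_swap. Qed.

Lemma reduces_wle r s : reduces r s -> wle s r.
Proof.
elim=> [u|u s' w /contracts_wle h _ h']; first exact: wle_refl.
exact: wle_trans h' h.
Qed.

Lemma reduces_trans s r u : reduces r s -> reduces s u -> reduces r u.
Proof. by elim=> // a b c ab _ IH /IH; apply: reduces_step ab. Qed.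

Lemma reduces_inv r u : reduces r u -> r = u \/ exists2 s, contracts r s & reduces s u.
Proof. by case=> [w|a b c ab bc]; [left | right; exists b]. Qed.

Lemma normal_form_exists r : exists d, normal_form r d.
Proof.
have [m] := ubnP #|inversions r|; elim: m r => // m IH r rm.
have [[s rs]|none] := classic (exists s, contracts r s).
  have [d [sd id]] := IH s (leq_trans (contracts_card rs) rm).
  by exists d; split=> //; apply: reduces_step rs sd.
by exists r; split=> [|s rs]; [apply: reduces_refl | case: none; exists s].
Qed.

Lemma reduces_compatible X r d : good X v -> compatible X v r -> reduces r d ->
  compatible X v d.
Proof.
move=> gX cX rd; elim: rd cX => // a b c [x [y [_ _ _ [Y [gY cYa cYb]]]]] _ IH cXa.
apply: IH; apply: compatible_ext cYb.
exact: compatible_unique gY gX cYa cXa.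
Qed.

Lemma flip_dichotomy X Y r x y : good X v -> compatible X v r -> (x < y)%N ->
  r x = (r y).+1 :> nat -> good Y v -> compatible Y v (tperm x y * r)%g ->
  (~ arc X y x /\ X =2 Y) \/
  (exists tA iA tB iB, flip_cells X x y tA iA tB iB /\ toggle X tA iA tB iB =2 Y).
Proof.
move=> gX cX xy adj gY cY; have ryx : (r y < r x)%N by lia.
have [a|na] := classic (arc X y x); last first.
  left; split=> //; apply: compatible_unique gX gY _ cY.
  exact: compatible_of_no_arc.
have [tA [iA [tB [iB f]]]] := flip_cells_exist gX xy a.
right; exists tA, iA, tB, iB; split=> //.
by apply: compatible_unique (flip_good gX xy f) gY (flip_compatible gX cX xy ryx f adj) cY.
Qed.

(** A flip of [x] and [y] leaves the trajectories of the other pipes unchanged, and the two toggled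
    tiles carry only [x] and [y]. *)
Lemma arc_toggle X x y tA iA tB iB a b : good X v -> (x < y)%N ->
  flip_cells X x y tA iA tB iB ->
  a != x -> a != y -> b != x -> b != y -> arc (toggle X tA iA tB iB) a b -> arc X a b.
Proof.
move=> gX xy f ax ay bx b_y [t [i [F Yt]]].
rewrite /enters !(flip_pos gX xy f) /swap_between.
rewrite ![tperm x y _]tpermD 1?eq_sym // !if_same => e.
exists t, i; split=> //; rewrite -Yt /toggle.
have fX := good_fits gX; have [_ hb] := e.
have -> : ((t == tA) && (i == iA)) = false.
  apply/andP => -[/eqP tt /eqP ii]; have [_ h] := flip_enterA f.
  by move/eqP: b_y; apply; apply: (pos_eq fX (t := t)); rewrite hb ii tt h.
have -> : ((t == tB) && (i == iB)) = false.
  apply/andP => -[/eqP tt /eqP ii]; have [_ h] := flip_enterB f.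
  by move/eqP: bx; apply; apply: (pos_eq fX (t := t)); rewrite hb ii tt h.
by rewrite addbF.
Qed.

Lemma contracts_no_arc X r x y : good X v -> compatible X v r -> (x < y)%N ->
  r x = (r y).+1 :> nat -> ~ arc X y x -> contracts r (tperm x y * r)%g.
Proof.
move=> gX cX xy adj na; exists x, y; split=> //; exists X; split=> //.
exact: compatible_of_no_arc.
Qed.

(** This relation makes the two sides of a hexagon end at the same permutation. *)
Lemma tperm_braid x y z : x != y -> y != z -> x != z ->
  (tperm x y * (tperm x z * tperm y z) = tperm x z)%g.
Proof.
move=> xy yz xz; apply/permP => a; rewrite !permM.
have zx : tperm x z y = y by rewrite tpermD // eq_sym.
have yx : tperm x y z = z by rewrite tpermD // eq_sym.
have yzx : tperm y z x = x by rewrite tpermD // eq_sym.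
have [->|ax] := eqVneq a x; first by rewrite !tpermL zx tpermL.
have [->|ay] := eqVneq a y; first by rewrite tpermR tpermL tpermR zx.
have [->|az] := eqVneq a z; first by rewrite yx !tpermR yzx.
by rewrite !(tpermD, eqxx) // eq_sym.
Qed.

(* The hexagon below a permutation containing the consecutive labels [z y x]
   with [x < y < z]. The pairs [(x1, y1)] and [(x2, y2)] are [(x, y)] and
   [(y, z)] in some order. *)
Lemma hexagon X r x z x1 y1 x2 y2 : good X v -> compatible X v r ->
  (x < z)%N -> (x1 < y1)%N -> (x2 < y2)%N -> ~ arc X z x ->
  let s := (tperm x1 y1 * r)%g in let s' := (tperm x z * s)%g in
  let m := (tperm x2 y2 * s')%g in
  let u := (tperm x2 y2 * r)%g in let u' := (tperm x z * u)%g in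
  r x2 = (r y2).+1 :> nat -> compatible X v s -> s x = (s z).+1 :> nat ->
  s' x2 = (s' y2).+1 :> nat -> u x = (u z).+1 :> nat -> u' x1 = (u' y1).+1 :> nat ->
  (m x < m z)%N -> m = (tperm x1 y1 * u')%g ->
  wle m s /\ reduces u m.
Proof.
move=> gX cX xz xy1 xy2 nzx s s' m u u' adj2 cs adjs adjs' adju adju' mxz mE.
split; first by apply: wle_trans (swap_wle adjs xz); apply: swap_wle.
have cs' : compatible X v s' by apply: compatible_of_no_arc.
have uv : wle u v.
  by apply: wle_trans (compatible_wle cX); apply: swap_wle.
have [Y [gY cY]] := exists_compatible gX uv.
(* [X] is also compatible with [s'], and the move across [(x2, y2)] depends only on [X]: made at
   [s'] it yields the same [Y], now compatible with [m]. *)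
have cYm : compatible Y v m.
  have ry2 : (s' y2 < s' x2)%N by lia.
  have [[na XY]|[tA [iA [tB [iB [f XY]]]]]] := flip_dichotomy gX cX xy2 adj2 gY cY.
    by apply: (compatible_ext XY); apply: compatible_of_no_arc.
  by apply: (compatible_ext XY); apply: flip_compatible.
have nYzx : ~ arc Y z x by move/(cYm.1)/(ltn_trans mxz); rewrite ltnn.
have cu' : compatible Y v u' by apply: compatible_of_no_arc.
apply: (reduces_step (s := u')); first exact: contracts_no_arc gY cY xz adju nYzx.
apply: reduces_step (reduces_refl _).
by exists x1, y1; split=> //; exists Y; split=> //.
Qed.

(** Two distinct descents of [r] either share a label, which gives a hexagon, or are disjoint, which
    gives a square where flipping [x] and [y] creates no contact from [y1] to [x1]. *)
Lemma polygon X0 r s x y : good X0 v -> wle r v -> contracts r s -> (x < y)%N ->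
  r x = (r y).+1 :> nat -> s <> (tperm x y * r)%g ->
  exists m, wle m s /\ reduces (tperm x y * r)%g m.
Proof.
move=> gX0 rv [x1 [y1 [xy1 adj1 -> [X [gX cX cs]]]]] xy2 adj2 ns.
set u := (tperm x y * r)%g in ns *.
have uv : wle u v by apply: wle_trans rv; apply: swap_wle.
have inj (a b : 'I_n) : r a = r b :> nat -> a = b by move/val_inj/perm_inj.
have dif (a b : 'I_n) : r a <> r b :> nat -> a != b by move=> h; apply/eqP => e; apply: h; rewrite e.
have vinv (a b : 'I_n) : (a < b)%N -> (r b < r a)%N -> (v b < v a)%N := wleP _ _ rv a b.
have nots : ~ arc X y1 x1 by move/(cs.1)/(ltn_trans (swap_rank_xy adj1)); rewrite ltnn.
have three (a b c : 'I_n) : (a < b)%N -> (b < c)%N -> r b = (r c).+1 :> nat ->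
    r a = (r b).+1 :> nat -> [/\ ~ arc X c a, tperm a b c = c, tperm a c b = b,
      tperm b c a = a &
      (tperm a b * (tperm a c * tperm b c) = tperm b c * (tperm a c * tperm a b))%g].
  move=> ab bc rbc rab.
  have nab : a != b by apply: dif; lia.
  have nbc : b != c by apply: dif; lia.
  have nac : a != c by apply: dif; lia.
  split; try by rewrite tpermD // eq_sym.
    by apply: (no_arc_321 gX cX ab bc); rewrite ?vinv //; lia.
  rewrite tperm_braid // (tpermC b c) (tpermC a c) (tpermC a b) tperm_braid // eq_sym //.
have [e1|ne1] := eqVneq y1 y.
  by case: ns; rewrite /u (_ : x1 = x) ?e1 //; apply: inj; rewrite adj1 adj2 e1.
have [e2|ne2] := eqVneq x1 y.
  subst x1; have [nar t1 t2 t3 br] := three x y y1 xy2 xy1 adj1 adj2.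
  exists (tperm x y * (tperm x y1 * (tperm y y1 * r)))%g.
  apply: (hexagon (x := x) (z := y1) gX cX) => //.
  - exact: ltn_trans xy2 xy1.
  all: rewrite /u ?permM ?(tpermL, tpermR, t1, t2, t3, permM); try done.
    by rewrite adj2 adj1 ltnS leqnSn.
  by rewrite !mulgA in br *; rewrite br.
have [e3|ne3] := eqVneq y1 x.
  subst y1; have [nar t1 t2 t3 br] := three x1 x y xy1 xy2 adj2 adj1.
  exists (tperm x y * (tperm x1 y * (tperm x1 x * r)))%g.
  apply: (hexagon (x := x1) (z := y) gX cX) => //.
  - exact: ltn_trans xy1 xy2.
  all: rewrite /u ?permM ?(tpermL, tpermR, t1, t2, t3, permM); try done.
    by rewrite adj1 adj2 ltnS leqnSn.
  by rewrite !mulgA in br *; rewrite br.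
have nx : x1 != x.
  by apply/eqP => e; move: ne1; rewrite (inj y1 y) ?eqxx //; move: adj1 adj2; rewrite e; lia.
have comm : (tperm x1 y1 * tperm x y = tperm x y * tperm x1 y1)%g.
  apply/permP => a; rewrite !permM.
  have t1 : tperm x y x1 = x1 by rewrite tpermD // eq_sym.
  have t2 : tperm x y y1 = y1 by rewrite tpermD // eq_sym.
  have t3 : tperm x1 y1 x = x by rewrite tpermD // eq_sym.
  have t4 : tperm x1 y1 y = y by rewrite tpermD // eq_sym.
  have [->|ax] := eqVneq a x; first by rewrite t3 tpermL t4.
  have [->|ay] := eqVneq a y; first by rewrite t4 tpermR t3.
  have [->|a1] := eqVneq a x1; first by rewrite tpermL t2 t1 tpermL.
  have [->|a2] := eqVneq a y1; first by rewrite tpermR t1 t2 tpermR.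
  by rewrite !tpermD // eq_sym.
exists (tperm x1 y1 * u)%g; split.
  rewrite /u mulgA comm -mulgA; apply: swap_wle => //.
  by rewrite !permM !tpermD // eq_sym.
have [Y [gY cY]] := exists_compatible gX0 uv.
apply: reduces_step (reduces_refl _); apply: (contracts_no_arc gY cY xy1).
  by rewrite !permM !tpermD // eq_sym.
have [[na XY] a|[tA [iA [tB [iB [f XY]]]]] a] := flip_dichotomy gX cX xy2 adj2 gY cY.
  by apply: nots; apply: arc_ext a => t i; rewrite XY.
by apply: nots; apply: (arc_toggle gX xy2 f) => //; apply: arc_ext a => t i; rewrite XY.
Qed.

(** Induction in the manner of Newman's lemma. Besides a contraction of [r'] to [s], there is a
    lower cover [r2] of [r'] with an element below it whose normal form is [d]. By [polygon], [r2]
    reduces to some [p] below [s], so [d] is below the normal form of [p], which is below [d']. *)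
Lemma normal_form_mono X0 r r' d d' : good X0 v -> wle r' v -> wle r r' ->
  normal_form r d -> normal_form r' d' -> wle d d'.
Proof.
move=> gX0; have [m] := ubnP #|inversions r'|.
elim: m r r' d d' => // m IH r r' d d' r'm r'v rr' nd nd'.
rewrite ltnS in r'm; have [red' ird'] := nd'; have [red ird] := nd.
have [e|[s r's sd']] := reduces_inv red'.
  by subst d'; apply: wle_trans (reduces_wle red) rr'.
have [r2 [x [y [xy adj r2E rr2]]]] : exists r2 x y, [/\ (x < y)%N, r' x = (r' y).+1 :> nat,
    r2 = (tperm x y * r')%g & exists r3, wle r3 r2 /\ normal_form r3 d].
  have [e|ne] := eqVneq r r'.
    subst r; have [e|[s2 r's2 sd2]] := reduces_inv red.
      by subst d; case: (ird s).
    have [x [y [xy adj s2E _]]] := r's2.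
    by exists s2, x, y; split=> //; exists s2; split=> //; apply: wle_refl.
  have [x [y [xy adj rxy]]] := exists_descent rr' (elimN eqP ne).
  by exists (tperm x y * r')%g, x, y; split=> //; exists r; split=> //; apply: wle_swap.
have [r3 [r32 nd3]] := rr2.
have r2v : wle r2 v by apply: wle_trans r'v; rewrite r2E; apply: swap_wle.
have sv : wle s v by apply: wle_trans r'v; apply: contracts_wle.
have r2m : (#|inversions r2| < m)%N.
  by apply: leq_trans r'm; rewrite r2E; apply: card_inversions_swap.
have sm : (#|inversions s| < m)%N by apply: leq_trans r'm; apply: contracts_card.
have nds : normal_form s d' by split.
have [es|nes] := eqVneq s r2.
  by subst s; apply: (IH r3 r2).
have [p [ps r2p]] : exists p : 'S_n, wle p s /\ reduces r2 p.
  rewrite r2E; apply: (polygon gX0 r'v r's xy adj).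
  by rewrite -r2E; apply/eqP.
have [dp [pdp idp]] := normal_form_exists p.
apply: (wle_trans (s := dp)).
  by apply: (IH r3 r2) => //; split=> //; apply: reduces_trans r2p pdp.
by apply: (IH p s).
Qed.

Lemma normal_form_unique X0 r d d' : good X0 v -> wle r v ->
  normal_form r d -> normal_form r d' -> d = d'.
Proof.
move=> gX0 rv nd nd'; apply: wle_antisym.
  exact: (normal_form_mono gX0 rv (wle_refl r)).
exact: (normal_form_mono gX0 rv (wle_refl r)).
Qed.

Lemma normal_form_contracts X0 r s d : good X0 v -> wle r v -> contracts r s ->
  normal_form r d -> normal_form s d.
Proof.
move=> gX0 rv rs nd; have [e [se ie]] := normal_form_exists s.
have nre : normal_form r e by split=> //; apply: reduces_step rs se.
by rewrite (normal_form_unique gX0 rv nd nre).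
Qed.

(** Linear extensions of one relation are connected by exchanges of consecutive labels: exchanging a
    consecutive pair on which [s] disagrees stays compatible with [X], and is a contraction in one
    of the two directions. *)
Lemma normal_form_class X r s d e : good X v -> compatible X v r -> compatible X v s ->
  normal_form r d -> normal_form s e -> d = e.
Proof.
move=> gX.
pose discord r s := [set ab : 'I_n * 'I_n | (r ab.1 < r ab.2)%N && (s ab.2 < s ab.1)%N].
have [m] := ubnP #|discord r s|; elim: m r d => // m IH r d; rewrite ltnS => rsm cr cs nd ne.
have sv := compatible_wle cs; have rv := compatible_wle cr.
have [[a [b [adj sba]]]|none] := classic (exists a b : 'I_n,
    r b = (r a).+1 :> nat /\ (s b < s a)%N); last first.
  have rs : s = r.
    apply: perm_eq_adjacent => a b ab; case: (ltngtP (s a) (s b)) => // [sba|/val_inj/perm_inj e'].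
      by case: none; exists a, b.
    by move: ab; rewrite e'; lia.
  by subst s; apply: (normal_form_unique gX rv nd).
set r1 := (tperm b a * r)%g.
have order p q : ~ (p = a /\ q = b) -> ~ (p = b /\ q = a) -> (r1 p < r1 q)%N = (r p < r q)%N.
  by move=> h1 h2; exact: (swap_rank_lt adj h2 h1).
have r1ba : (r1 b < r1 a)%N by apply: swap_rank_xy.
have c1 : compatible X v r1.
  split=> p q.
    move=> pq; have h1 := cr.1 p q pq; have h2 := cs.1 p q pq.
    by rewrite order // => -[? ?]; subst; lia.
  move=> pq vpq; have h1 := cr.2 p q pq vpq; have h2 := cs.2 p q pq vpq.
  by rewrite order // => -[? ?]; subst; lia.
have r1m : (#|discord r1 s| < m)%N.
  apply: leq_trans rsm; apply: proper_card; apply/properP; split.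
    apply/subsetP => -[p q]; rewrite !inE /= => /andP[h1 h2]; rewrite h2 andbT.
    rewrite -order // => -[? ?]; subst; first by have := ltn_trans h1 r1ba; rewrite ltnn.
    by have := ltn_trans h2 sba; rewrite ltnn.
  exists (a, b); rewrite !inE /= ?sba ?andbT ?adj ?ltnSn //.
  by rewrite -leqNgt ltnW.
have [d1 nd1] := normal_form_exists r1.
have -> : d = d1.
  case: (ltngtP a b) => [ab|ba|/val_inj e'].
  - have con : contracts r1 r.
      exists a, b; split=> //.
      + by rewrite !permM tpermL tpermR adj.
      + by rewrite /r1 tpermC mulgA tperm2 mul1g.
      by exists X; split.
    exact: (normal_form_unique gX rv nd (normal_form_contracts gX (compatible_wle c1) con nd1)).
  - have con : contracts r r1 by exists b, a; split=> //; exists X; split.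
    exact: (normal_form_unique gX (compatible_wle c1) (normal_form_contracts gX rv con nd) nd1).
  by move: sba; rewrite e' ltnn.
exact: (IH r1).
Qed.
End NormalForms.
End Network.

(** * The network of an alternating shape *)

Import Order.TTheory GRing.Theory Num.Theory.

Lemma path_vertex0 (p : int * int) s : path_vertex p s 0 = p.
Proof. by rewrite /path_vertex take0 big_nil addr0. Qed.

Lemma path_vertexS (p : int * int) s i : (i < size s)%N ->
  path_vertex p s i.+1 = (path_vertex p s i + nth 0 s i)%R.
Proof.
by move=> h; rewrite /path_vertex (take_nth 0%R h) -cats1 big_cat big_seq1 addrA.
Qed.

Lemma path_edges_cons (p u : int * int) s :
  path_edges p (u :: s) = step_edge p u :: path_edges (p + u)%R s.
Proof.
rewrite /path_edges /mkseq /= {1}/path_edge path_vertex0 /=; congr (_ :: _).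
rewrite -[1%N]addn0 iotaDl -map_comp; apply: eq_map => i /=.
by rewrite /path_edge /path_vertex /= big_cons addrA.
Qed.

(** Horizontal edges are those met when following a column southwards, which is how the cells are
    determined below. *)
Lemma NW_stair_edges (t : nat) (p : int * int) (c : int * int) :
  ((true, c) \in path_edges p (NW_stair t)) =
  (c.1 - p.1 + 1 == c.2 - p.2)%R && (0 <= c.1 - p.1 < t%:Z)%R.
Proof.
elim: t p => [|t IH] p; first by rewrite in_nil; lia.
have -> : NW_stair t.+1 = [:: north, east & NW_stair t] by [].
rewrite !path_edges_cons !inE IH {IH} /step_edge /=.
case: c p => c1 c2 [p1 p2] /=.
have -> : ((p1, p2) + north = (p1 + 0, p2 + 1))%R by [].
by rewrite !xpair_eqE /=; lia.
Qed.

Lemma SE_stair_edges (t : nat) (p : int * int) (c : int * int) :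
  ((true, c) \in path_edges p (SE_stair t)) =
  (c.1 - p.1 == c.2 - p.2)%R && (0 <= c.1 - p.1 < t%:Z)%R.
Proof.
elim: t p => [|t IH] p; first by rewrite in_nil; lia.
have -> : SE_stair t.+1 = [:: east, north & SE_stair t] by [].
rewrite !path_edges_cons !inE IH {IH} /step_edge /=.
case: c p => c1 c2 [p1 p2] /=.
by rewrite !xpair_eqE /=; lia.
Qed.

Definition height (c : int * int) : int := (c.1 + c.2)%R.

Lemma se_step (s : seq (int * int)) (p : int * int) (i : nat) : all (mem [:: south; east]) s -> (i < size s)%N ->
  (nth 0%R s i = east /\ (path_vertex p s i.+1).1 = (path_vertex p s i).1 + 1 /\
     (path_vertex p s i.+1).2 = (path_vertex p s i).2)%R \/
  (nth 0%R s i = south /\ (path_vertex p s i.+1).1 = (path_vertex p s i).1 /\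
     (path_vertex p s i.+1).2 = (path_vertex p s i).2 - 1)%R.
Proof.
move=> /allP hs h; rewrite path_vertexS //; move: (hs _ (mem_nth 0%R h)).
rewrite !inE => /orP[] /eqP ->; [right | left]; split=> //=; lia.
Qed.

Lemma se_diag (s : seq (int * int)) (p : int * int) (i : nat) : all (mem [:: south; east]) s -> (i <= size s)%N ->
  ((path_vertex p s i).1 - (path_vertex p s i).2 = p.1 - p.2 + i%:Z)%R.
Proof.
move=> hs; elim: i => [|i IH] h; first by rewrite path_vertex0 addr0.
by have := IH (ltnW h); case: (se_step p hs h) => -[_ [-> ->]]; lia.
Qed.

Lemma se_height (s : seq (int * int)) (p : int * int) (i : nat) : all (mem [:: south; east]) s -> (i <= size s)%N ->
  (height p - i%:Z <= height (path_vertex p s i) <= height p + i%:Z)%R.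
Proof.
rewrite /height => hs; elim: i => [|i IH] h; first by rewrite path_vertex0; lia.
by have := IH (ltnW h); case: (se_step p hs h) => -[_ [-> ->]]; lia.
Qed.

Lemma se_edges (s : seq (int * int)) (p : int * int) (c : int * int) (i : nat) :
  all (mem [:: south; east]) s -> (c.1 - c.2 = p.1 - p.2 + i%:Z)%R -> (i < size s)%N ->
  ((true, c) \in path_edges p s) =
  (height (path_vertex p s i) == height c) &&
  (height (path_vertex p s i.+1) == height (path_vertex p s i) + 1)%R.
Proof.
move=> hs ci h; apply/idP/idP => [/mapP[k]|].
  rewrite mem_iota add0n => /= kn; rewrite /path_edge /step_edge.
  have dk := se_diag p hs (ltnW kn).
  case: (se_step p hs kn) => -[-> [e1 e2]]; last by [].
  rewrite eqxx => -[cE].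
  have ik : i = k by move: dk; rewrite -cE ci; lia.
  by subst k; rewrite -cE eqxx /height e1 e2 -cE; lia.
move=> /andP[/eqP h1 /eqP h2].
have dk := se_diag p hs (ltnW h).
apply/mapP; exists i; first by rewrite mem_iota.
rewrite /path_edge /step_edge; move: h1 h2; rewrite /height.
case: (se_step p hs h) => -[-> [e1 e2]]; rewrite e1 e2 => h1 h2; last by lia.
rewrite eqxx; congr pair.
rewrite [LHS]surjective_pairing [RHS]surjective_pairing; congr pair; lia.
Qed.

Lemma se_edges_out (s : seq (int * int)) (p : int * int) (c : int * int) :
  all (mem [:: south; east]) s ->
  (c.1 - c.2 < p.1 - p.2 \/ p.1 - p.2 + (size s)%:Z <= c.1 - c.2)%R ->
  (true, c) \in path_edges p s = false.
Proof.
move=> hs out; apply/negP => /mapP[k].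
rewrite mem_iota add0n => /= kn; rewrite /path_edge /step_edge.
have dk := se_diag p hs (ltnW kn).
case: (se_step p hs kn) => -[-> [e1 e2]]; last by [].
by rewrite eqxx => -[cE]; move: dk; rewrite -cE; lia.
Qed.

(** * The shape as the region between [lo] and [hi] *)

Section Shape.
Variables (n : nat) (F : alternating_shape n).
Hypothesis hn : (2 <= n)%N.

Let V i := path_vertex 0%R (starting F) i.
Let W i := path_vertex (nw_corner F) (ending F) i.

Lemma height_origin : height 0%R = 0%R.
Proof. by []. Qed.

Lemma height_nw : height (nw_corner F) = ((nw_length F)%:Z + (nw_length F)%:Z)%R.
Proof. by []. Qed.

Lemma V_diag i : (i <= n)%N -> ((V i).1 - (V i).2 = i%:Z)%R.
Proof.
by move=> h; rewrite /V (se_diag _ (starting_steps F)) ?size_tuple // add0r.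
Qed.

Lemma W_diag i : (i <= n)%N -> ((W i).1 - (W i).2 = i%:Z)%R.
Proof.
move=> h; rewrite /W (se_diag _ (ending_steps F)) ?size_tuple // /nw_corner /=; lia.
Qed.

(* Anti-diagonals are shifted by [2n] so that they can be counted in [nat]. *)
Definition lo i : nat := absz (height (V i) + (n + n)%N%:Z)%R.
Definition hi i : nat := absz (height (W i) + (n + n)%N%:Z)%R.

Lemma loE i : (i <= n)%N -> ((lo i)%:Z = height (V i) + (n + n)%N%:Z)%R.
Proof.
move=> h; have := @se_height (starting F) 0%R i (starting_steps F).
by rewrite size_tuple => /(_ h); rewrite /lo -/(V i) height_origin; lia.
Qed.

Lemma hiE i : (i <= n)%N -> ((hi i)%:Z = height (W i) + (n + n)%N%:Z)%R.
Proof.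
move=> h; have := @se_height (ending F) (nw_corner F) i (ending_steps F).
by rewrite size_tuple => /(_ h); rewrite /hi -/(W i) height_nw; lia.
Qed.

Lemma lo_step i : (i < n)%N -> lo i.+1 = (lo i).+1 \/ lo i = (lo i.+1).+1.
Proof.
move=> h; have := loE h; have := loE (ltnW h).
have hs : (i < size (starting F))%N by rewrite size_tuple.
rewrite /height /V; case: (se_step 0%R (starting_steps F) hs) => -[_ [-> ->]]; lia.
Qed.

Lemma hi_step i : (i < n)%N -> hi i.+1 = (hi i).+1 \/ hi i = (hi i.+1).+1.
Proof.
move=> h; have := hiE h; have := hiE (ltnW h).
have hs : (i < size (ending F))%N by rewrite size_tuple.
rewrite /height /W; case: (se_step (nw_corner F) (ending_steps F) hs) => -[_ [-> ->]]; lia.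
Qed.

Lemma lo_gt0 i : (i <= n)%N -> (0 < lo i)%N.
Proof.
move=> h; have := loE h; have := @se_height (starting F) 0%R i (starting_steps F).
by rewrite size_tuple => /(_ h); rewrite -/(V i) height_origin; lia.
Qed.

(** The ending path starts at height [2 * nw_length] and rises by at most [n]; the final [n + n] is
    the shift of anti-diagonals. *)
Definition horizon : nat := (nw_length F + nw_length F + n + (n + n))%N.

Lemma hi_le i : (i <= n)%N -> (hi i <= horizon)%N.
Proof.
move=> h; have := hiE h; have := @se_height (ending F) (nw_corner F) i (ending_steps F).
by rewrite size_tuple => /(_ h); rewrite -/(W i) height_nw /horizon; lia.
Qed.

Lemma lo_parity i : (i <= n)%N -> ~~ odd (lo i + i).
Proof. by move=> h; have := loE h; have := V_diag h; rewrite /height; lia. Qed.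

Lemma hi_parity i : (i <= n)%N -> ~~ odd (hi i + i).
Proof. by move=> h; have := hiE h; have := W_diag h; rewrite /height; lia. Qed.

Lemma lo_lt_hi i : (0 < i < n)%N -> (lo i < hi i)%N.
Proof.
move=> h; have [h1 h2] := ending_strictly_NE F h.
have in_ : (i <= n)%N by lia.
by have := loE in_; have := hiE in_; rewrite /height /V /W; lia.
Qed.

Lemma lo_hi0 : lo 0 = (n + n)%N /\ hi 0 = (nw_length F + nw_length F + (n + n))%N.
Proof.
have := loE (leq0n n); have := hiE (leq0n n).
by rewrite /V /W !path_vertex0 /height /nw_corner /=; lia.
Qed.

Lemma lo_hin : hi n = (lo n + (se_length F + se_length F))%N.
Proof.
have := loE (leqnn n); have := hiE (leqnn n).
by rewrite /V /W (se_stair_end F) /height /=; lia.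
Qed.

Lemma lo_le_hi i : (i <= n)%N -> (lo i <= hi i)%N.
Proof.
have [i0|i0] := posnP i; first by subst i; have := lo_hi0; lia.
rewrite leq_eqVlt => /orP[/eqP->|h]; first by have := lo_hin; lia.
by rewrite ltnW // lo_lt_hi // i0.
Qed.

Definition region_cell (c : int * int) : bool :=
  [&& 0 <= c.1 - c.2, (c.1 - c.2 <= n%:Z),
      ((lo (absz (c.1 - c.2)%R))%:Z <= height c + (n + n)%N%:Z) &
      (height c + (n + n)%N%:Z < (hi (absz (c.1 - c.2)%R))%:Z)]%R.

(** The south side of a cell of diagonal [i] can lie on the NW stair only for [i = -1], on the SE
    stair only for [i = n], and on the other two paths only in between. *)
Lemma boundary_region (c : int * int) :
  (south_side c \in boundary F) = (region_cell c != region_cell (c + south)%R).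
Proof.
rewrite /boundary /south_side !mem_cat NW_stair_edges SE_stair_edges.
have Vn := V_diag (leqnn n); have Ln := loE (leqnn n).
move: Vn Ln; rewrite -/(V n); case: (V n) => a b.
case: c => c1 c2; rewrite /region_cell /south /height /= => Vn Ln.
have [l0 h0] := lo_hi0; have hnE := lo_hin.
have [neg|nneg] := boolP (c1 - c2 < 0)%R.
  rewrite !se_edges_out ?starting_steps ?ending_steps //; try by left; rewrite /nw_corner /=; lia.
  have [e|ne] := eqVneq (c1 - c2 + 1)%R 0%R; last by lia.
  have -> : (absz (c1 + 0 - (c2 + -1))%R) = 0%N by lia.
  by rewrite l0 h0; lia.
have [big|nbig] := boolP (n%:Z <= c1 - c2)%R.
  rewrite !se_edges_out ?starting_steps ?ending_steps //;
    try by right; rewrite /nw_corner size_tuple /=; lia.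
  have [e|ne] := eqVneq (c1 - c2)%R (n%:Z)%R; last by lia.
  have -> : (absz (c1 - c2)%R) = n by lia.
  by rewrite hnE; lia.
have [i iE] : exists i : nat, (c1 - c2 = i%:Z)%R by exists (absz (c1 - c2)%R); lia.
have iltn : (i < n)%N by lia.
have d1 : (c1 - c2 = (0%R : int * int).1 - (0%R : int * int).2 + i%:Z)%R by rewrite iE /=; lia.
have d2 : (c1 - c2 = (nw_corner F).1 - (nw_corner F).2 + i%:Z)%R by rewrite iE /=; lia.
rewrite (@se_edges (starting F) 0%R (c1, c2) i (starting_steps F) d1) ?size_tuple //.
rewrite (@se_edges (ending F) (nw_corner F) (c1, c2) i (ending_steps F) d2) ?size_tuple //.
rewrite -!/(V _) -!/(W _).
have -> : (absz (c1 - c2)%R) = i by lia.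
have -> : (absz (c1 + 0 - (c2 + -1))%R) = i.+1 by lia.
have := loE (ltnW iltn); have := loE iltn; have := hiE (ltnW iltn); have := hiE iltn.
have := lo_step iltn; have := hi_step iltn.
have := lo_parity (ltnW iltn); have := hi_parity (ltnW iltn).
have := lo_le_hi (ltnW iltn); have := lo_le_hi iltn.
have s1 : (0 < i)%N -> (lo i < hi i)%N by move=> i0; apply: lo_lt_hi; rewrite i0.
have s2 : (i.+1 < n)%N -> (lo i.+1 < hi i.+1)%N by move=> i0; apply: lo_lt_hi; rewrite i0.
have -> : height (c1, c2) = (c1 + c2)%R by [].
have -> : (c1 - 0 + 1 == c2 - 0)%R = false by clear -iE; lia.
have -> : (c1 - a == c2 - b)%R = false by clear -iE iltn Vn; lia.
have -> : (0 <= c1 - c2)%R by clear -iE; lia.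
have -> : (c1 - c2 <= n%:Z)%R by clear -iE iltn; lia.
have -> : (0 <= c1 + 0 - (c2 + -1))%R by clear -iE; lia.
have -> : (c1 + 0 - (c2 + -1) <= n%:Z)%R by clear -iE iltn; lia.
have -> : (c1 + 0 + (c2 + -1) = c1 + c2 - 1)%R by clear; lia.
rewrite !andFb orbF !andTb /=.
have par : exists k : int, (c1 + c2 = k + k + i%:Z)%R by exists c2; clear -iE; lia.
(* Since [n >= 2], one end of the edge lies on an inner diagonal, where the two paths are strictly
   apart; hence they never share an edge. *)
have mid : (0 < i)%N \/ (i.+1 < n)%N by clear -hn; lia.
move: par mid s1 s2; clear -iltn => -[k ->]; clear.
move: (lo i) (lo i.+1) (hi i) (hi i.+1) (height _) (height _) (height _) (height _).
move=> l l' h h' A B C D mid s1 s2 le1 le2 p1 p2 [e1|e1] [e2|e2] E1 E2 E3 E4; subst.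
all: case: mid => [/s1|/s2]; clear s1 s2; lia.
Qed.

Lemma cells_bounded : exists M : nat, forall c, c \in cells F -> (absz c.2 <= M)%N.
Proof.
exists (\max_(c <- enum_fset (cells F)) absz c.2)%N => c cF.
exact: (@leq_bigmax_seq _ (enum_fset (cells F)) xpredT (fun c : int * int => absz c.2) c cF isT).
Qed.

Definition southwards (c : int * int) (k : nat) : int * int := (c.1, c.2 - k%:Z)%R.

(* Along a column both sets change membership at the same boundary edges, and
   far to the south they both are empty. *)
Lemma mem_cells (c : int * int) : (c \in cells F) = region_cell c.
Proof.
apply/eqP; apply: contraT => neq; exfalso.
have all_neq k : (southwards c k \in cells F) != region_cell (southwards c k).
  elim: k => [|k IH].
    by rewrite /southwards subr0 -surjective_pairing.
  have sE : (southwards c k + south)%R = southwards c k.+1.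
    by rewrite /southwards /south; congr pair => /=; lia.
  have := horizontal_boundary F (southwards c k); rewrite boundary_region sE.
  by move: IH; do 4!case: (_ \in _) || case: (region_cell _).
have [M hM] := cells_bounded.
(* So far south, the second coordinate exceeds the bound [M] in absolute value and the diagonal is
   beyond [n]. *)
have := all_neq (absz c.1 + absz c.2 + n + M + 1)%N.
set c' := southwards _ _.
have -> : (c' \in cells F) = false.
  by apply/negP => /hM; rewrite /c' /southwards /=; lia.
have -> : region_cell c' = false.
  by rewrite /region_cell /c' /southwards /=; lia.
by [].
Qed.

(** * Cells and edges in network coordinates *)

Notation in_region := (in_region n lo hi).

(** Solves [x + y = t - 2n] and [x - y = i]. *)
Definition cell_at (t i : nat) : int * int :=
  let x := ((t + i)./2%:Z - n%:Z)%R in (x, x - i%:Z)%R.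

Definition diag (c : int * int) : nat := absz (c.1 - c.2)%R.
Definition time (c : int * int) : nat := absz (height c + (n + n)%N%:Z)%R.

Lemma diag_cell_at t i : diag (cell_at t i) = i.
Proof. by rewrite /diag /cell_at /=; lia. Qed.

Lemma time_cell_at t i : ~~ odd (t + i) -> time (cell_at t i) = t.
Proof. by rewrite /time /cell_at /height /=; lia. Qed.

Lemma cell_at_mem t i : ~~ odd (t + i) -> (cell_at t i \in cells F) = in_region t i.
Proof.
move=> ti; rewrite mem_cells /region_cell -/(diag _) diag_cell_at /in_region ti andbT.
have -> : ((cell_at t i).1 - (cell_at t i).2 = i%:Z)%R by rewrite /cell_at /=; lia.
have -> : (height (cell_at t i) + (n + n)%N%:Z = t%:Z)%R.
  by rewrite /cell_at /height /=; lia.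
lia.
Qed.

Lemma cell_atK (c : int * int) : c \in cells F ->
  [/\ in_region (time c) (diag c), cell_at (time c) (diag c) = c & ~~ odd (time c + diag c)].
Proof.
move=> cF; have := cF; rewrite mem_cells => /and4P[d0 dn l0 h0].
have dn' : (diag c <= n)%N by rewrite /diag; lia.
have tE : (height c + (n + n)%N%:Z = (time c)%:Z)%R by rewrite /time; lia.
have dE : (c.1 - c.2 = (diag c)%:Z)%R by rewrite /diag; lia.
have par : ~~ odd (time c + diag c) by move: tE dE; rewrite /height; clear; lia.
have cE : cell_at (time c) (diag c) = c.
  move: tE dE par; rewrite /height /cell_at; clear; case: c => c1 c2 /=.
  by move: (time _) (diag _) => t i *; congr pair; lia.
by split=> //; rewrite -cell_at_mem ?cE.
Qed.

Definition edge_at (t j : nat) : bool * (int * int) :=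
  if odd (t + j) then west_side (cell_at t j.+1) else south_side (cell_at t j).

Lemma edge_at_inj t j t' j' : edge_at t j = edge_at t' j' -> t = t' /\ j = j'.
Proof.
rewrite /edge_at; case: ifP => o; case: ifP => o' // -[h1 h2].
  have := congr1 diag (f_equal2 pair h1 h2); rewrite !diag_cell_at => -[jj].
  subst j'; split=> //; move: h1; move: o o'; clear; lia.
have := congr1 diag (f_equal2 pair h1 h2); rewrite !diag_cell_at => jj.
subst j'; split=> //; move: h1; move: o o'; clear; lia.
Qed.

Lemma cell_at_north t i : (0 < i)%N -> (cell_at t i + north)%R = cell_at t.+1 i.-1.
Proof. by move=> i0; rewrite /cell_at; congr pair => /=; lia. Qed.

Lemma cell_at_east t i : (cell_at t i + east)%R = cell_at t.+1 i.+1.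
Proof. by rewrite /cell_at; congr pair => /=; lia. Qed.

Lemma edge_at_S t i : ~~ odd (t + i) -> edge_at t i = south_side (cell_at t i).
Proof. by rewrite /edge_at => /negPf ->. Qed.

Lemma edge_at_W t i : ~~ odd (t + i.+1) -> edge_at t i = west_side (cell_at t i.+1).
Proof. by rewrite /edge_at addnS /= negbK => ->. Qed.

(** An edge is dated by its lower end, whence the minimum over the two ends of a step. *)
Definition entry_time i := minn (lo i) (lo i.+1).
Definition exit_time i := minn (hi i) (hi i.+1).

Lemma cell_at_lo i : (i <= n)%N -> cell_at (lo i) i = V i.
Proof.
move=> h; have := V_diag h; have := loE h; rewrite /cell_at /height.
by case: (V i) => a b /=; move: (lo i) => l *; congr pair; lia.
Qed.

Lemma cell_at_hi i : (i <= n)%N -> cell_at (hi i) i = W i.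
Proof.
move=> h; have := W_diag h; have := hiE h; rewrite /cell_at /height.
by case: (W i) => a b /=; move: (hi i) => l *; congr pair; lia.
Qed.

Lemma entry_edgeE (a : 'I_n) : entry_edge F a = edge_at (entry_time a) a.
Proof.
have an := ltn_ord a; have an' := ltnW an.
have hs : (a < size (starting F))%N by rewrite size_tuple.
have l1 := loE an; have l0 := loE an'; have p0 := lo_parity an'; have p1 := lo_parity an.
have c1 := cell_at_lo an; have c0 := cell_at_lo an'.
rewrite /entry_edge /path_edge /step_edge -/(V a).
have VS : V a.+1 = (V a + nth 0%R (starting F) a)%R by rewrite /V path_vertexS.
have h12 := se_step 0%R (starting_steps F) hs.
rewrite -/(V a) -/(V a.+1) in h12.
case: h12 VS => -[-> [e1 e2]] VS.
  have tE : entry_time a = lo a by move: l1 l0; rewrite /height /entry_time e1 e2; clear; lia.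
  by rewrite eqxx tE edge_at_S // c0.
have tE : entry_time a = lo a.+1 by move: l1 l0; rewrite /height /entry_time e1 e2; clear; lia.
by rewrite /= tE edge_at_W // c1 VS.
Qed.

Lemma exit_edgeE (a : 'I_n) : exit_edge F a = edge_at (exit_time a) a.
Proof.
have an := ltn_ord a; have an' := ltnW an.
have hs : (a < size (ending F))%N by rewrite size_tuple.
have l1 := hiE an; have l0 := hiE an'; have p0 := hi_parity an'; have p1 := hi_parity an.
have c1 := cell_at_hi an; have c0 := cell_at_hi an'.
rewrite /exit_edge /path_edge /step_edge -/(W a).
have WS : W a.+1 = (W a + nth 0%R (ending F) a)%R by rewrite /W path_vertexS.
have h12 := se_step (nw_corner F) (ending_steps F) hs.
rewrite -/(W a) -/(W a.+1) in h12.
case: h12 WS => -[-> [e1 e2]] WS.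
  have tE : exit_time a = hi a by move: l1 l0; rewrite /height /exit_time e1 e2; clear; lia.
  by rewrite eqxx tE edge_at_S // c0.
have tE : exit_time a = hi a.+1 by move: l1 l0; rewrite /height /exit_time e1 e2; clear; lia.
by rewrite /= tE edge_at_W // c1 WS.
Qed.

Definition is_cross (x : tile) : bool := if x is Cross then true else false.

Definition cross_at (P : filling F) (c : int * int) : bool :=
  if insub c is Some d then is_cross (P d) else false.

Lemma cross_at_val (P : filling F) (c : cells F) : cross_at P (val c) = is_cross (P c).
Proof. by rewrite /cross_at valK. Qed.

Definition crosses (P : filling F) (t i : nat) : bool :=
  [&& (0 < i < n)%N, in_region t i & cross_at P (cell_at t i)].

Lemma crosses_fits (P : filling F) : fits n lo hi (crosses P).
Proof. by move=> t i /and3P[]. Qed.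

(** The time bound serves the induction of [exit_stairs_contact]: up to time [T] the pipes of the
    filling follow the network. *)
Definition stairs_contact (P : filling F) (T : nat) : Prop :=
  forall c : cells F, (diag (val c) == 0%N) || (diag (val c) == n) ->
    (time (val c) < T)%N -> P c = Contact.

Lemma advance_out (P : filling F) t j : in_region t (cell_of t j) = false ->
  advance P (edge_at t j) = edge_at t j.
Proof.
move=> h; rewrite /advance.
suff -> : insub (edge_at t j).2 = None :> option (cells F) by [].
apply: insubF; move: h; rewrite /cell_of /edge_at; case: ifP => o /=.
  by rewrite cell_at_mem //; lia.
by rewrite cell_at_mem // o.
Qed.

Lemma advance_step (P : filling F) T t j : stairs_contact P T -> (t < T)%N -> (j < n)%N ->
  in_region t (cell_of t j) -> advance P (edge_at t j) = edge_at t.+1 (step (crosses P) t j).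
Proof.
move=> sc tT jn; set k := cell_of t j => reg.
have tk : ~~ odd (t + k) by case/and3P: reg.
have kF : cell_at t k \in cells F by rewrite cell_at_mem.
pose c : cells F := FSetSub kF.
have inC : insub (cell_at t k) = Some c by rewrite insubT /c; congr Some; apply: val_inj.
have XE : crosses P t k = is_cross (P c).
  rewrite /crosses reg /cross_at inC /=.
  have [//|out] := boolP (0 < k < n)%N.
  rewrite sc //= ?diag_cell_at ?time_cell_at //.
  have : (k <= n)%N by case/and3P: reg.
  lia.
have off i : odd (t + i) -> crosses P t i = false.
  by move=> o; rewrite /crosses /in_region o !andbF.
have [e1 e2] : (edge_at t j).1 = ~~ odd (t + j) /\ (edge_at t j).2 = cell_at t k.
  by rewrite /k /cell_of /edge_at; case: ifP.
have vc : val c = cell_at t k by [].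
rewrite /advance e1 e2 inC {e1 e2} vc; move: (P c) tk XE => Pc {inC}.
rewrite /k /cell_of {c kF reg k}; case: ifP => o tk XE.
  rewrite /step (off j) ?o // XE /=.
  case: Pc {XE} => /=.
    by rewrite /east_side cell_at_east -edge_at_W //; lia.
  by rewrite /north_side cell_at_north //= -edge_at_S //; lia.
rewrite /step XE /=.
case: Pc XE => /= XE.
  have j0 : (0 < j)%N by case/and3P: XE => /andP[].
  by rewrite /north_side cell_at_north // -edge_at_S //; lia.
by rewrite off ?/east_side ?cell_at_east -?edge_at_W //; lia.
Qed.

Section Pipes.
Variable X : nat -> nat -> bool.
Hypothesis fX : fits n lo hi X.

Lemma pos_before_entry t (a : 'I_n) : (t <= entry_time a)%N -> pos X t a = a.
Proof.
elim: t => //= t IH h; rewrite IH; last by apply: ltnW.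
have no i : (t < lo i)%N -> X t i = false.
  move=> ti; apply/negP => /fX[_ /and3P[_ /andP[l _] _]].
  by move: ti; rewrite ltnNge l.
by rewrite /step !no //; move: h; rewrite /entry_time; clear; lia.
Qed.

Lemma step_after_exit t j : (j < n)%N -> (exit_time j <= t)%N -> step X t j = j.
Proof.
move=> jn h; have p0 := hi_parity (ltnW jn); have p1 := hi_parity jn.
have s := hi_step jn.
rewrite /step; case: ifP => [/fX[_ /and3P[_ /andP[_ h'] o]]|_].
  by exfalso; move: h h' o p0 s; rewrite /exit_time; clear; lia.
case: ifP => // /fX[_ /and3P[_ /andP[_ h'] o]].
by exfalso; move: h h' o p1 s; rewrite /exit_time; clear; lia.
Qed.

Lemma pos_after_exit t t' (a : 'I_n) : (exit_time (pos X t a) <= t)%N -> (t <= t')%N ->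
  pos X t' a = pos X t a.
Proof.
move=> h /subnKC <-; elim: (t' - t)%N => [|d IH]; first by rewrite addn0.
have jn := pos_lt t a fX.
by rewrite addnS /= IH step_after_exit //; apply: leq_trans h (leq_addr _ _).
Qed.

Lemma region_before_exit t j : (j < n)%N -> in_region t (cell_of t j) -> (t < exit_time j)%N.
Proof.
move=> jn /and3P[_ /andP[_ h] _].
have p0 := hi_parity (ltnW jn); have p1 := hi_parity jn; have s := hi_step jn.
by move: h p0 p1 s; rewrite /cell_of /exit_time; clear; case: ifP; lia.
Qed.

Lemma cell_of_le t j : (j < n)%N -> (cell_of t j <= n)%N.
Proof. by rewrite /cell_of; case: ifP => // _ /ltnW. Qed.

Lemma cell_of_even t j : ~~ odd (t + cell_of t j).
Proof. by rewrite /cell_of; case: ifP => //; clear; lia. Qed.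

Lemma not_region_exit t j : (j < n)%N -> (lo (cell_of t j) <= t)%N ->
  in_region t (cell_of t j) = false -> (exit_time j <= t)%N.
Proof.
move=> jn l; rewrite /in_region cell_of_le // l cell_of_even /= andbT => /negbT.
rewrite -leqNgt; have s := hi_step jn.
by rewrite /cell_of /exit_time; move: s; clear; case: ifP; lia.
Qed.

Lemma lo_entry (a : 'I_n) : lo (cell_of (entry_time a) a) = entry_time a.
Proof.
have an := ltn_ord a; have s := lo_step an.
have p0 := lo_parity (ltnW an); have p1 := lo_parity an.
by rewrite /cell_of /entry_time; move: s p0 p1; clear; case: ifP; lia.
Qed.

Lemma lo_lipschitz i j : (i <= n)%N -> (j <= n)%N -> (lo j <= lo i + ((i - j) + (j - i)))%N.
Proof.
move=> hi' hj; case: (leqP i j) => ij.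
  have := lipschitz lo_step (i := i) (d := j - i); rewrite subnKC // => /(_ hj) [h _].
  by move: h ij; clear; lia.
have := lipschitz lo_step (i := j) (d := i - j); rewrite subnKC ?(ltnW ij) // => /(_ hi') [_ h].
by move: h ij; clear; lia.
Qed.

(** A pipe enters on the starting path and then moves north and east; as [lo] is 1-Lipschitz, it
    never falls back behind that path. *)
Lemma lo_le_cell t (a : 'I_n) : (entry_time a <= t)%N -> (lo (cell_of t (pos X t a)) <= t)%N.
Proof.
move=> h.
move: (path_monotone fX a h) (lo_entry a) (cell_of_le (entry_time a) (ltn_ord a)).
move: (cell_of_le t (pos_lt t a fX)) h; rewrite (pos_before_entry (leqnn _)).
move: (cell_of (entry_time a) a) (cell_of t (pos X t a)) (entry_time a).
move=> k k' e k1 h [h1 h2] l k0; have := lo_lipschitz k0 k1; move: h1 h2 l h; clear; lia.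
Qed.

Lemma entry_le_region t (a : 'I_n) : in_region t (cell_of t (pos X t a)) ->
  (entry_time a <= t)%N.
Proof.
move=> /and3P[_ /andP[l _] _]; rewrite leqNgt; apply/negP => h.
move: l; rewrite pos_before_entry ?(ltnW h) //.
by move: h; rewrite /entry_time /cell_of; clear; case: ifP; lia.
Qed.

Lemma region_before_pos_exit u t (a : 'I_n) : (entry_time a <= u)%N -> (u <= t)%N ->
  (u < exit_time (pos X t a))%N -> in_region u (cell_of u (pos X u a)).
Proof.
move=> h ut hu; apply: contraLR hu => /negbTE nr.
have hx := not_region_exit (pos_lt u a fX) (lo_le_cell h) nr.
by rewrite (pos_after_exit hx ut) -leqNgt.
Qed.
End Pipes.

(** * Pipes of a filling followed edge by edge *)

Section Walk.
Variable P : filling F.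
Let X := crosses P.
Let fX : fits n lo hi X := @crosses_fits P.

(** The time [t] may lag behind [entry_time a + k], because [advance] stops once the pipe has left
    the shape. *)
Lemma walk T (a : 'I_n) k : stairs_contact P T -> (entry_time a + k <= T)%N ->
  exists2 t, (entry_time a <= t <= entry_time a + k)%N &
    iter k (advance P) (entry_edge F a) = edge_at t (pos X t a).
Proof.
move=> sc; elim: k => [|k IH] hk.
  exists (entry_time a); first by rewrite addn0 leqnn.
  by rewrite /= entry_edgeE pos_before_entry.
have [t ht IHt] := IH (leq_trans (leq_add (leqnn _) (leqnSn k)) hk).
rewrite iterS IHt; case: (boolP (in_region t (cell_of t (pos X t a)))) => r.
  exists t.+1; first by move: ht; clear; lia.
  rewrite (advance_step sc _ (pos_lt t a fX) r) //.
  by move: ht hk; clear; lia.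
exists t; first by move: ht; clear; lia.
by rewrite advance_out //; apply: negbTE.
Qed.

Lemma walk_to T (a : 'I_n) t : stairs_contact P T -> (entry_time a <= t <= T)%N ->
  (forall u, (entry_time a <= u < t)%N -> in_region u (cell_of u (pos X u a))) ->
  iter (t - entry_time a) (advance P) (entry_edge F a) = edge_at t (pos X t a).
Proof.
move=> sc /andP[/subnKC <-]; move: (t - entry_time a)%N => d; rewrite addKn.
elim: d => [|d IH] hT reg; first by rewrite addn0 /= entry_edgeE pos_before_entry.
have dlt : (entry_time a + d < entry_time a + d.+1)%N by rewrite addnS.
rewrite iterS IH.
- rewrite addnS (advance_step sc _ (pos_lt _ a fX)) //; first by rewrite -addnS.
  by apply: reg; rewrite leq_addr dlt.
- exact: leq_trans (ltnW dlt) hT.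
by move=> u /andP[h1 h2]; apply: reg; rewrite h1 (ltn_trans h2 dlt).
Qed.

Lemma passes_pos (a : 'I_n) t j : (forall T, stairs_contact P T) ->
  passes P a (edge_at t j) -> pos X t a = j.
Proof.
move=> sc [k hk]; have [u _ e] := @walk _ a k (sc _) (leqnn _).
by move: hk; rewrite e => /edge_at_inj [-> ->].
Qed.

Lemma pos_passes (a : 'I_n) t : (forall T, stairs_contact P T) ->
  (entry_time a <= t)%N -> (t <= exit_time (pos X t a))%N ->
  passes P a (edge_at t (pos X t a)).
Proof.
move=> sc h1 h2; exists (t - entry_time a)%N.
apply: (walk_to (T := t)) => //; first by rewrite h1 leqnn.
move=> u /andP[hu1 hu2]; apply: (region_before_pos_exit fX hu1 (ltnW hu2)).
exact: leq_trans hu2 h2.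
Qed.

Lemma passes_region (a : 'I_n) t j : (forall T, stairs_contact P T) ->
  in_region t (cell_of t j) -> pos X t a = j -> passes P a (edge_at t j).
Proof.
move=> sc r e; subst j; apply: pos_passes => //.
  exact: (entry_le_region fX r).
by apply/ltnW/(region_before_exit (pos_lt t a fX)).
Qed.

Lemma passes_west (a : 'I_n) (c : cells F) : (forall T, stairs_contact P T) ->
  passes P a (west_side (val c)) <-> (pos X (time (val c)) a).+1 = diag (val c).
Proof.
move=> sc; have [r cE par] := cell_atK (valP c).
move: r cE par; set t := time _; set i := diag _ => r cE par.
split=> [[k hk]|h].
  have [u _ e] := @walk _ a k (sc _) (leqnn _).
  move: hk; rewrite e /edge_at /south_side /west_side.
  case: ifP => // o /(congr1 snd); rewrite [LHS]/= [RHS]/= => cc.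
  have iE : i = (pos X u a).+1 := etrans (esym (congr1 diag cc)) (diag_cell_at _ _).
  have par' : ~~ odd (u + (pos X u a).+1) by rewrite addnS /= negbK.
  have tE : t = u := etrans (esym (congr1 time cc)) (time_cell_at par').
  by rewrite tE iE.
rewrite -cE -h -edge_at_W ?h //; apply: passes_region => //.
by rewrite /cell_of (_ : odd _) ?h // ; move: par; rewrite -h; clear; lia.
Qed.

Lemma passes_south (a : 'I_n) (c : cells F) : (forall T, stairs_contact P T) ->
  passes P a (south_side (val c)) <-> pos X (time (val c)) a = diag (val c).
Proof.
move=> sc; have [r cE par] := cell_atK (valP c).
move: r cE par; set t := time _; set i := diag _ => r cE par.
split=> [[k hk]|h].
  have [u _ e] := @walk _ a k (sc _) (leqnn _).
  move: hk; rewrite e /edge_at /south_side /west_side.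
  case: ifP => // o /(congr1 snd); rewrite [LHS]/= [RHS]/= => cc.
  have iE : i = pos X u a := etrans (esym (congr1 diag cc)) (diag_cell_at _ _).
  have tE : t = u := etrans (esym (congr1 time cc)) (time_cell_at (negbT o)).
  by rewrite tE iE.
rewrite -cE -edge_at_S //; apply: passes_region => //.
by rewrite /cell_of (negPf par).
Qed.

(** From [exit_time i] on, the strip [i] meets no cross, so exits can be read at the horizon. *)
Lemma exit_pos (w : 'S_n) : (forall T, stairs_contact P T) ->
  exit_permutation P w <-> forall a : 'I_n, pos X horizon a = (w^-1)%g a.
Proof.
move=> sc; have exit_le (i : 'I_n) : (exit_time i <= horizon)%N.
  by rewrite /exit_time (leq_trans (geq_minl _ _)) // hi_le // ltnW.
split=> [ex a|hpos i].
  have := ex ((w^-1)%g a); rewrite permKV exit_edgeE => /(passes_pos sc) h.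
  by rewrite (pos_after_exit fX (t := exit_time ((w^-1)%g a))) ?h.
have hT : pos X horizon (w i) = i by rewrite hpos permK.
have at_exit d t : (t + d = horizon)%N -> (exit_time i <= t)%N -> pos X t (w i) = i.
  elim: d t => [|d IH] t; first by rewrite addn0 => ->.
  rewrite addnS -addSn => td ht; rewrite (pos_pred _ _ fX) (IH t.+1) ?(leq_trans ht) //.
  exact: step_after_exit.
have e := at_exit _ _ (subnKC (exit_le i)) (leqnn _).
have := pos_passes (a := w i) (t := exit_time i) sc.
rewrite exit_edgeE e leqnn => go; apply: go => //.
rewrite leqNgt; apply/negP => h.
have := e; rewrite (pos_before_entry fX (ltnW h)) => /val_inj wi; move: h; rewrite wi.
have := lo_le_hi (ltnW (ltn_ord i)); have := lo_le_hi (ltn_ord i).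
by rewrite /entry_time /exit_time; clear; lia.
Qed.

(* A pipe crossing a stair leaves the shape away from the ending path. *)
Lemma exit_stairs_contact (w : 'S_n) : exit_permutation P w -> forall T, stairs_contact P T.
Proof.
move=> ex; elim=> [|T IH] c st ct //.
have [ctT|Tct] := ltnP (time (val c)) T; first exact: IH.
case Pc: (P c) => //; exfalso.
have {ct Tct} tE : time (val c) = T by apply/eqP; rewrite eqn_leq Tct andbT -ltnS.
have [r cE par] := cell_atK (valP c); rewrite tE in r cE par.
have n0 : (0 < n)%N by apply: ltnW.
pose j := if diag (val c) == 0%N then 0%N else n.-1.
have jn : (j < n)%N by rewrite /j; case: ifP => // _; rewrite prednK.
have [a ha] := pos_surj T fX jn.
have cellE : cell_of T j = diag (val c).
  move: st par; rewrite /j /cell_of; case: eqP => [-> _|_ /= /eqP ->] par.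
    by rewrite (negPf par).
  by move: par n0; clear; case: ifP; lia.
have rT : in_region T (cell_of T (pos X T a)) by rewrite ha cellE.
have entT := entry_le_region fX rT.
have exT := region_before_exit jn (_ : in_region T (cell_of T j)).
have {}exT : (T < exit_time j)%N by apply: exT; rewrite cellE.
have walkT : iter (T - entry_time a) (advance P) (entry_edge F a) = edge_at T j.
  rewrite -ha; apply: (walk_to IH); first by rewrite entT leqnn.
  move=> u /andP[h1 h2]; apply: (region_before_pos_exit fX h1 (ltnW h2)).
  by rewrite ha; apply: ltn_trans h2 exT.
(* [out] is the edge reached by crossing the stair: [advance] is stuck there, and it is the edge of
   no strip, in particular no exit edge. *)
have [out [outE outF outD]] : exists out, [/\ advance P (edge_at T j) = out,
    out.2 \notin cells F & forall t i : nat, (i < n)%N -> out <> edge_at t i].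
  have ins : insub (cell_at T (diag (val c))) = Some c by rewrite cE valK.
  have [d0|dn] := eqVneq (diag (val c)) 0%N.
    rewrite {1}/j d0 eqxx; rewrite d0 in ins par cE.
    exists (north_side (val c)); split.
    - by rewrite edge_at_S // /advance /= ins Pc.
    - by rewrite /north_side /south_side [snd _]/= -cE mem_cells /region_cell /cell_at /=; clear; lia.
    move=> t i _; rewrite /north_side -cE /edge_at /south_side /west_side; case: ifP => // _.
    by move=> /(congr1 (fun e => (e.2.1 - e.2.2)%R)); rewrite /cell_at /=; clear; lia.
  have {}st : diag (val c) = n by move: st; rewrite (negPf dn) => /eqP.
  rewrite {1}/j (negPf dn); rewrite st in ins par cE.
  exists (east_side (val c)); split.
  - have nE : n = n.-1.+1 by rewrite prednK.
    rewrite edge_at_W -?nE // /advance /= ins Pc //.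
  - by rewrite /east_side /west_side [snd _]/= -cE mem_cells /region_cell /cell_at /=; clear; lia.
  move=> t i i_n; rewrite /east_side -cE /edge_at /south_side /west_side; case: ifP => // _.
  by move=> /(congr1 (fun e => (e.2.1 - e.2.2)%R)); rewrite /cell_at /=; move: i_n; clear; lia.
have stuck m : iter m (advance P) out = out.
  by elim: m => //= m ->; rewrite /advance insubF //; apply: negbTE.
have [k] := ex ((w^-1)%g a); rewrite permKV exit_edgeE; set j' := (w^-1)%g a => hk.
have [kT|Tk] := leqP k (T - entry_time a)%N.
  have ekT : (entry_time a + k <= T)%N by rewrite -leq_subRL.
  have := walk_to (t := entry_time a + k) (a := a) IH; rewrite leq_addr ekT => /(_ isT).
  rewrite addKn hk => walkk.
  have reg u : (entry_time a <= u < entry_time a + k)%N -> in_region u (cell_of u (pos X u a)).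
    move=> /andP[h1 h2]; apply: (region_before_pos_exit fX h1 (t := T)).
      exact: leq_trans (ltnW h2) ekT.
    by rewrite ha; apply: ltn_trans exT; apply: leq_trans h2 ekT.
  have [e1 e2] := edge_at_inj (walkk reg).
  have h : (exit_time (pos X (entry_time a + k) a) <= entry_time a + k)%N by rewrite -e2 e1.
  have := pos_after_exit fX h ekT; rewrite ha => jE.
  by move: exT; rewrite jE -e2 e1 ltnNge ekT.
move: hk; rewrite -(subnK Tk) addnS -addSn iterD walkT iterSr outE stuck.
exact: outD.
Qed.
End Walk.

(** * Crossings, contacts and reducedness in the network *)

Lemma crosses_val (P : filling F) (c : cells F) : (forall T, stairs_contact P T) ->
  crosses P (time (val c)) (diag (val c)) = is_cross (P c).
Proof.
move=> sc; have [r cE _] := cell_atK (valP c).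
rewrite /crosses r cE cross_at_val /=; have [//|out] := boolP (0 < diag (val c) < n)%N.
rewrite (sc (time (val c)).+1) //; have /and3P[dn _ _] := r.
by move: out dn; clear; lia.
Qed.

Lemma crosses_cell (P : filling F) t i : crosses P t i ->
  exists c : cells F, [/\ time (val c) = t, diag (val c) = i & P c = Cross].
Proof.
move=> /and3P[_ r X].
have ti : ~~ odd (t + i) by case/and3P: r.
have cF : cell_at t i \in cells F by rewrite cell_at_mem.
exists (FSetSub cF); rewrite /= time_cell_at // diag_cell_at; split=> //.
by move: X; rewrite /cross_at insubT; case: (P _).
Qed.

Lemma fillings_ext (P Q : filling F) : (forall T, stairs_contact P T) ->
  (forall T, stairs_contact Q T) -> crosses P =2 crosses Q -> P = Q.
Proof.
move=> sP sQ E; apply/ffunP => c.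
by have := E (time (val c)) (diag (val c)); rewrite !crosses_val //; case: (P c); case: (Q c).
Qed.

Lemma crossingE (P : filling F) (a b : 'I_n) (c : cells F) : (forall T, stairs_contact P T) ->
  crossing P a b c <-> (crosses P (time (val c)) (diag (val c)) /\
    meets (crosses P) (time (val c)) (diag (val c)) a b).
Proof.
move=> sc; rewrite crosses_val // /crossing /meets /enters.
have wa := passes_west a c sc; have wb := passes_west b c sc.
have sa := passes_south a c sc; have sb := passes_south b c sc.
split=> [[-> [[/wa ? /sb ?]|[/wb ? /sa ?]]]|[]].
- by split=> //; left.
- by split=> //; right.
by case: (P c) => // _ [[/wa ? /sb ?]|[/wb ? /sa ?]]; split=> //; [left|right].
Qed.

Lemma contact_arcE (P : filling F) (a b : 'I_n) : (forall T, stairs_contact P T) ->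
  contact_arc P a b <-> arc lo hi (crosses P) a b.
Proof.
move=> sc; split=> [[c [Pc /(passes_west _ _ sc) h1 /(passes_south _ _ sc) h2]]|].
  exists (time (val c)), (diag (val c)); split=> //.
    by case: (cell_atK (valP c)).
  by rewrite crosses_val // Pc.
move=> [t [i [r X [h1 h2]]]].
have ti : ~~ odd (t + i) by case/and3P: r.
have cF : cell_at t i \in cells F by rewrite cell_at_mem.
have tE : time (val (FSetSub cF)) = t by rewrite /= time_cell_at.
have iE : diag (val (FSetSub cF)) = i by rewrite /= diag_cell_at.
exists (FSetSub cF); split.
- by have := @crosses_val P (FSetSub cF) sc; rewrite tE iE X; case: (P _).
- by apply/(passes_west _ _ sc); rewrite tE iE.
by apply/(passes_south _ _ sc); rewrite tE iE.
Qed.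

Lemma reduced_monotone (P : filling F) : (forall T, stairs_contact P T) ->
  reduced P <-> monotone n (crosses P).
Proof.
move=> sc; have fX := @crosses_fits P.
split=> [red a b t t' ab tt' h|mX a b].
  rewrite ltnNge leq_eqVlt; apply/negP => /orP[/eqP/(pos_eq fX) e|h'].
    by move: ab; rewrite e ltnn.
  have [u [i [/andP[_ ut] Xu eu]]] := order_change fX (leq0n t) (ab : pos _ 0 a < pos _ 0 b)%N h.
  have [u' [i' [/andP[tu' _] Xu' eu']]] := order_change fX tt' h h'.
  have [c [tc ic Pc]] := crosses_cell Xu; have [d [td id Pd]] := crosses_cell Xu'.
  have nab : a != b by apply/eqP => e; move: ab; rewrite e ltnn.
  have cc : crossing P a b c by apply/(crossingE _ _ _ sc); rewrite tc ic; split=> //; left.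
  have cd : crossing P a b d by apply/(crossingE _ _ _ sc); rewrite td id; split=> //; right.
  have e : u = u' by rewrite -tc -td (red a b nab c d cc cd).
  by move: ut; rewrite e ltnNge tu'.
wlog ab : a b / (a < b)%N => [hw nab c d cc cd|_ c d].
  have sym x : crossing P a b x -> crossing P b a x by move=> [? [?|?]]; split=> //; [right|left].
  case: (ltngtP a b) => [ab|ba|/val_inj e]; last by rewrite e eqxx in nab.
    exact: (hw a b).
  by apply: (hw b a) => //; [rewrite eq_sym | apply: sym | apply: sym].
move=> /(crossingE _ _ _ sc)[Xc mc] /(crossingE _ _ _ sc)[Xd md].
have [[c1 c2] oc] := cross_order fX mX ab Xc mc.
have [[d1 d2] od] := cross_order fX mX ab Xd md.
have tcd : time (val c) = time (val d).
  case: (ltngtP (time (val c)) (time (val d))) => // lt.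
    by have := mX _ _ _ _ ab lt oc; move: d1 d2; clear; lia.
  by have := mX _ _ _ _ ab lt od; move: c1 c2; clear; lia.
have icd : diag (val c) = diag (val d) by rewrite -c2 -d2 tcd.
apply: val_inj; have [_ <- _] := cell_atK (valP c); have [_ <- _] := cell_atK (valP d).
by rewrite tcd icd.
Qed.

(** * The acyclic order and the bottoms of classes *)

Section Lattice.
Variable w : 'S_n.
Let v : 'S_n := (w^-1)%g.
Local Notation good := (good horizon lo hi).
Local Notation compatible := (compatible lo hi).
Local Notation Sigma := (@strongly_acyclic_pipe_dream n F w).

Lemma pipe_dream_good (P : filling F) : reduced_pipe_dream w P ->
  (forall T, stairs_contact P T) /\ good (crosses P) v.
Proof.
move=> [ex red]; have sc := exit_stairs_contact ex; split=> //; split.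
- exact: crosses_fits.
- exact/(reduced_monotone sc).
exact/(exit_pos w sc).
Qed.

Lemma linE (P : filling F) (r : 'S_n) : (forall T, stairs_contact P T) ->
  lin w P (r^-1)%g <-> compatible (crosses P) v r.
Proof.
move=> sc; rewrite /lin invgK; split=> [h|[h1 h2] a b].
  split=> a b; first by move=> /(contact_arcE _ _ sc) ab; apply: h; left.
  move=> ab vab; apply: h; right; rewrite /noninversion /inversion ab /=.
  by rewrite -leqNgt ltnW.
case=> [/(contact_arcE _ _ sc)/h1 //|].
rewrite /noninversion /inversion => /andP[ab]; rewrite ab /= -leqNgt => vab.
apply: h2 => //; rewrite ltn_neqAle vab andbT; apply/eqP => /val_inj/perm_inj e.
by rewrite e ltnn in ab.
Qed.

Lemma weak_leE (r s : 'S_n) : weak_le (r^-1)%g (s^-1)%g <-> wle r s.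
Proof.
rewrite /weak_le /inversion !invgK; split=> [h|/wleP h a b /andP[ab rba]].
  by apply/wleP => a b ab rba; have := h a b; rewrite ab rba => /(_ isT).
by rewrite ab h.
Qed.

Lemma acyclic_leE (P Q : filling F) : (forall T, stairs_contact P T) ->
  (forall T, stairs_contact Q T) -> acyclic_le w P Q <->
  exists r s, [/\ compatible (crosses P) v r, compatible (crosses Q) v s & wle r s].
Proof.
move=> sP sQ; split=> [[p [q [lp lq pq]]]|[r [s [cr cs rs]]]].
  exists (p^-1)%g, (q^-1)%g; split.
  - by apply/(linE _ sP); rewrite invgK.
  - by apply/(linE _ sQ); rewrite invgK.
  by apply/weak_leE; rewrite !invgK.
exists (r^-1)%g, (s^-1)%g; split.
- exact/(linE _ sP).
- exact/(linE _ sQ).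
exact/weak_leE.
Qed.

Lemma compatible_exists (P : filling F) : Sigma P -> exists r, compatible (crosses P) v r.
Proof.
move=> [rp acy]; have [sc _] := pipe_dream_good rp.
have [r hr] := topological_sort acy.
by exists r; apply/(linE _ sc) => a b /hr; rewrite invgK.
Qed.

Lemma pipe_dream_exists (P0 : filling F) (r : 'S_n) : Sigma P0 -> wle r v ->
  exists P, Sigma P /\ compatible (crosses P) v r.
Proof.
move=> [/pipe_dream_good[_ g0] _] rv.
have [X [[fX mX eX] cX]] := exists_compatible hi_le g0 rv.
pose P : filling F := [ffun c => if X (time (val c)) (diag (val c)) then Cross else Contact].
have sc T : stairs_contact P T.
  move=> c st _; rewrite ffunE; case: ifP => // /fX[h _]; exfalso.
  have {}h : (0 < diag (val c) < n)%N := h.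
  by case/orP: st h => /eqP ->; rewrite ltnn ?andbF.
have XE : crosses P =2 X.
  move=> t i; apply/idP/idP => [/crosses_cell[c [<- <-]]|Xt].
    by rewrite ffunE; case: ifP.
  have [_ r'] := fX _ _ Xt; have ti : ~~ odd (t + i) by case/and3P: r'.
  have cF : cell_at t i \in cells F by rewrite cell_at_mem.
  have := @crosses_val P (FSetSub cF) sc.
  by rewrite ffunE /= time_cell_at // diag_cell_at Xt => ->.
have posE t (a : 'I_n) : pos (crosses P) t a = pos X t a by apply: pos_ext.
have XE' : X =2 crosses P by move=> t i; rewrite XE.
have cP := compatible_ext XE' cX.
exists P; split=> //; split; first split.
- by apply/(exit_pos w sc) => a; rewrite posE eX.
- by apply/(reduced_monotone sc) => a b t t'; rewrite !posE; apply: mX.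
have lP : lin w P (r^-1)%g by apply/(linE _ sc).
have inc a b : clos_trans _ (extended_arc w P) a b -> (r a < r b)%N.
  by elim=> [x y /lP|x y z _ h1 _ h2]; [rewrite invgK | apply: ltn_trans h1 h2].
by move=> x /inc; rewrite ltnn.
Qed.

(** By [normal_form_class] the choice of [r] is immaterial, so [d] is the minimum of the class of
    [P] in the weak order. *)
Definition bottom_of (P : filling F) (d : 'S_n) : Prop :=
  exists r, compatible (crosses P) v r /\ normal_form horizon lo hi v r d.

Lemma bottom_exists (P : filling F) : Sigma P -> exists d, bottom_of P d.
Proof.
move=> /compatible_exists[r cr]; have [d nd] := normal_form_exists horizon lo hi v r.
by exists d, r.
Qed.

Lemma bottom_compatible (P : filling F) d : Sigma P -> bottom_of P d ->
  compatible (crosses P) v d.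
Proof.
move=> [/pipe_dream_good[_ g] _] [r [cr [rd _]]].
exact: (reduces_compatible hi_le g cr rd).
Qed.

Lemma acyclic_le_bottom (P Q : filling F) d e : Sigma P -> Sigma Q ->
  bottom_of P d -> bottom_of Q e -> acyclic_le w P Q <-> wle d e.
Proof.
move=> SP SQ bd be.
have [[/pipe_dream_good[sP gP] _] [/pipe_dream_good[sQ gQ] _]] := (SP, SQ).
rewrite (acyclic_leE sP sQ); split=> [[r [s [cr cs rs]]]|de]; last first.
  by exists d, e; split=> //; apply: bottom_compatible.
have [d1 nd1] := normal_form_exists horizon lo hi v r.
have [e1 ne1] := normal_form_exists horizon lo hi v s.
have [r' [cr' nd]] := bd; have [s' [cs' ne]] := be.
have uniq := normal_form_class lo_step hi_step lo_gt0 hi_le.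
rewrite (uniq _ _ _ _ _ _ gP cr' cr nd nd1) (uniq _ _ _ _ _ _ gQ cs' cs ne ne1).
exact: (normal_form_mono lo_step hi_step lo_gt0 hi_le gP (compatible_wle cs) rs nd1 ne1).
Qed.

Lemma acyclic_lattice : lattice_on Sigma (@acyclic_le n F w).
Proof.
have scP P : Sigma P -> forall T, stairs_contact P T by move=> [/pipe_dream_good[]].
split; first split.
- move=> P SP; have [d bd] := bottom_exists SP.
  by apply/(acyclic_le_bottom SP SP bd bd); apply: wle_refl.
- move=> P Q SP SQ; have [d bd] := bottom_exists SP; have [e be] := bottom_exists SQ.
  move=> /(acyclic_le_bottom SP SQ bd be) de /(acyclic_le_bottom SQ SP be bd) ed.
  have e_d := wle_antisym de ed; subst e.
  have [[/pipe_dream_good[sP gP] _] [/pipe_dream_good[sQ gQ] _]] := (SP, SQ).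
  apply: fillings_ext => //.
  exact: (compatible_unique hi_le gP gQ (bottom_compatible SP bd) (bottom_compatible SQ be)).
- move=> P Q R SP SQ SR; have [d bd] := bottom_exists SP; have [e be] := bottom_exists SQ.
  have [f bf] := bottom_exists SR.
  move=> /(acyclic_le_bottom SP SQ bd be) de /(acyclic_le_bottom SQ SR be bf) ef.
  by apply/(acyclic_le_bottom SP SR bd bf); apply: wle_trans ef.
move=> P Q SP SQ; have [d bd] := bottom_exists SP; have [e be] := bottom_exists SQ.
have cd := bottom_compatible SP bd; have ce := bottom_compatible SQ be.
have dv := compatible_wle cd; have ev := compatible_wle ce.
split.
  have [m [md me greatest]] := weak_meet d e.
  have [M [SM cm]] := pipe_dream_exists SP (wle_trans md dv).
  exists M; split=> //.
  - by apply/(acyclic_leE (scP _ SM) (scP _ SP)); exists m, d.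
  - by apply/(acyclic_leE (scP _ SM) (scP _ SQ)); exists m, e.
  move=> Z SZ; have [z bz] := bottom_exists SZ.
  move=> /(acyclic_le_bottom SZ SP bz bd) zd /(acyclic_le_bottom SZ SQ bz be) ze.
  apply/(acyclic_leE (scP _ SZ) (scP _ SM)); exists z, m.
  by split=> //; [apply: bottom_compatible | apply: greatest].
have [j [uj least]] := weak_join [set d; e].
have dj : wle d j by apply: uj; rewrite !inE eqxx.
have ej : wle e j by apply: uj; rewrite !inE eqxx orbT.
have jv : wle j v by apply: least => r; rewrite !inE => /orP[]/eqP->.
have [J [SJ cj]] := pipe_dream_exists SP jv.
exists J; split=> //.
- by apply/(acyclic_leE (scP _ SP) (scP _ SJ)); exists d, j.
- by apply/(acyclic_leE (scP _ SQ) (scP _ SJ)); exists e, j.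
move=> Z SZ; have [z bz] := bottom_exists SZ.
move=> /(acyclic_le_bottom SP SZ bd bz) dz /(acyclic_le_bottom SQ SZ be bz) ez.
apply/(acyclic_leE (scP _ SJ) (scP _ SZ)); exists j, z; split=> //.
  exact: bottom_compatible.
by apply: least => r; rewrite !inE => /orP[]/eqP->.
Qed.
End Lattice.
End Shape.

Theorem theorem2p14 (n : nat) (hn : (2 <= n)%N) (F : alternating_shape n)
    (w : 'S_n) (hw : sortable F w) :
  lattice_on (@strongly_acyclic_pipe_dream n F w) (@acyclic_le n F w).
Proof. exact: acyclic_lattice. Qed.
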